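(* Let $n\geq 11$. Call two permutations $\sigma,\pi\in\operatorname{Sym}(n)$ $3$-setwise intersecting if there is a $3$-subset $S\subseteq\{1,2,\ldots,n\}$ with $S^\sigma=S^\pi$, and call $\mathcal{F}\subseteq\operatorname{Sym}(n)$ $3$-setwise intersecting if any two permutations of $\mathcal{F}$ are $3$-setwise intersecting. If $\mathcal{F}\subseteq \operatorname{Sym}(n)$ is $3$-setwise intersecting, then $|\mathcal{F}|\leq 6(n-3)!$. Moreover, if $|\mathcal{F}|=6(n-3)!$, then the characteristic vector $v_{\mathcal{F}}$ of $\mathcal{F}$ lies in $U_{[n]}\oplus U_{[n-1,1]}\oplus U_{[n-2,2]}\oplus U_{[n-3,3]}$, i.e. in the direct sum of the isotypic components $U_\chi$ of $\mathbb{C}\operatorname{Sym}(n)$ over the irreducible constituents $\chi$ of the permutation character of $\operatorname{Sym}(n)$ acting on the $3$-subsets of $\{1,\ldots,n\}$ (these constituents are $\chi^{[n]},\chi^{[n-1,1]},\chi^{[n-2,2]},\chi^{[n-3,3]}$).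
   Context: The characteristic vector $v_{\mathcal{F}}\in\mathbb{C}^{\operatorname{Sym}(n)}$ has entry $1$ at $g\in\mathcal{F}$ and $0$ otherwise. Identify $\mathbb{C}^{\operatorname{Sym}(n)}$ with the regular module $\mathbb{C}\operatorname{Sym}(n)$. For $\lambda\vdash n$, $\chi^\lambda$ is the irreducible character of the Specht module $S^\lambda$, and $U_\lambda$ is the sum of all submodules of the regular module $\mathbb{C}\operatorname{Sym}(n)$ isomorphic to $S^\lambda$ (the $\chi^\lambda$-isotypic component). *)

(* Defs.v *)
From HB Require Import structures.
From mathcomp Require Import all_boot all_order all_algebra all_fingroup all_solvable all_field all_character.
Set Implicit Arguments. Unset Strict Implicit. Unset Printing Implicit Defensive.
Import GRing.Theory Num.Theory.
Local Open Scope ring_scope.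

(* Sym(n) is the group of all permutations of 'I_n = {0,...,n-1}. *)
Definition SymG (n : nat) : {group 'S_n} := [set: 'S_n]%G.

(* the 3-subsets of {0,..,n-1} *)
Definition three_sets (n : nat) : {set {set 'I_n}} := [set S : {set 'I_n} | #|S| == 3%N].

(* sigma, pi are 3-setwise intersecting: S^sigma = S^pi for some 3-subset S *)
Definition setwise3 (n : nat) (s p : 'S_n) : Prop :=
  exists2 S : {set 'I_n}, #|S| = 3%N & s @: S = p @: S.

Definition setwise3_family (n : nat) (F : {set 'S_n}) : Prop :=
  forall s p, s \in F -> p \in F -> setwise3 s p.

(* permutation character of Sym(n) acting on 3-subsets: number of fixed 3-sets *)
Definition perm_char3 (n : nat) (g : 'S_n) : algC :=
  (#|[set S in three_sets n | g @: S == S]|)%:R.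

(* chi_i is an irreducible constituent of perm_char3:  '[perm_char3, chi_i] <> 0,
   the inner product written out (up to the nonzero factor 1/|G|). *)
Definition constituent3 (n : nat) (i : Iirr (SymG n)) : bool :=
  (\sum_(g in SymG n) perm_char3 g * ('chi[SymG n]_i g)^*) != 0.

(* characteristic vector of F, in the regular module C Sym(n) encoded as row
   vectors indexed by gring_index (the coordinates of regular_repr). *)
Definition char_vec (n : nat) (F : {set 'S_n}) : 'rV[algC]_#|SymG n| :=
  \sum_(g in F) delta_mx 0 (gring_index (SymG n) g).

(* direct sum of the isotypic components U_chi (sum of all submodules of the
   regular module isomorphic to the irreducible affording chi) over the
   irreducible constituents chi of perm_char3 *)
Definition U_constituents3 (n : nat) : 'M[algC]_#|SymG n| :=
  (\sum_(i | constituent3 i) (socle_of_Iirr i : 'M_#|SymG n|))%MS.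

(* Main.v *)
(** A weighted ratio bound. Put weights, summing to 4(N - 1) with N = C(n, 3), on
    permutations of the six cycle types in [weighted_types], none of which fixes
    a 3-set, and for an irreducible character chi let T_chi be 4 chi(1) plus the
    weighted sum of the values of chi. The energy
    q_chi = sum_(s, t in F) chi(s t^-1) is a sum of squares, and column
    orthogonality gives sum_chi T_chi q_chi = 4 n! |F|, because no s t^-1 with
    s, t in F is conjugate to a weighted permutation. Since T_1 = 4N,
    q_1 = |F|^2 and all T_chi >= 0, we get N |F| <= n!. In the case of equality
    q_chi = 0 whenever chi <> 1 and T_chi > 0, which includes every chi that is
    not a constituent, and q_chi = 0 kills the projection of v_F to U_chi.

    The signs of the T_chi come from the Murnaghan-Nakayama rule for the
    characters given by Frobenius' determinantal formula. If the first row and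
    the first column of the partition have length at most n - 4, then
    chi(1) >= N, while for n >= 13 all the weighted values of chi are 0 or
    +-1; the cases n = 11, 12 are computed. The other partitions are, up to
    conjugation, (n - k, nu) with k <= 3. *)

From Stdlib Require Import ZArith.
Require Import Defs.
From HB Require Import structures.
From mathcomp Require Import all_boot all_order all_algebra all_fingroup all_solvable all_field all_character.
From mathcomp Require Import zify ssrZ ring.
Set Implicit Arguments. Unset Strict Implicit. Unset Printing Implicit Defensive.
Import GroupScope Order.TTheory GRing.Theory Num.Theory.
Local Open Scope ring_scope.

(** The weights are forced. Give both types of each pair (n), (n-4,4); (n-2,2), (n-6,4,2);
    (n-2,1,1), (n-6,4,1,1) one common weight. The irreducible characters of (n-1,1), (n-2,2),
    (n-3,3) are constant on each pair, so T_chi = 0 for these three is a linear system in three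
    unknowns, and the factor 4 makes its solution integral. The permutation character on 3-sets is
    the sum of the trivial character and these three and vanishes on all six types, so T_1 = 4N and
    the total weight 4(N - 1) follow. The bound n >= 11 is where (n-4,4), of degree
    n(n-1)(n-2)(n-7)/24, reaches degree N. The irreducible characters are given abstractly, so each
    has to be matched with a partition before the Murnaghan-Nakayama rule applies. Orthonormality of
    Frobenius' characters is Cauchy's identity det(1/(1 - x_i y_j)) = V(x) V(y) / prod (1 - x_i
    y_j), with V the Vandermonde determinant, compared coefficient by coefficient; an extremal
    argument then shows that every irreducible character is one of them up to sign. *)

(** * Cauchy's determinant identity, coefficient by coefficient *)

Section MatchingDeterminant.
Variable l : nat.
Implicit Types b c : 'I_l -> nat.

Definition lower b (i : 'I_l) (m : nat) : 'I_l -> nat :=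
  fun k => if k == i then (b k - m)%N else b k.

(** The coefficient of x^b y^c in det(1/(1 - x_i y_j)). *)
Definition match_det b c : int := \det (\matrix_(i, j) (b i == c j)%:R).

Lemma match_detE b c :
  match_det b c = \sum_(s : 'S_l) (-1) ^+ s * \prod_i (b i == c (s i))%:R.
Proof.
by apply: eq_bigr => s _; congr (_ * _); apply: eq_bigr => i _; rewrite mxE.
Qed.

(** Lowering two entries matched by s by the same m does not change whether they agree, and b i
    values of m are admissible. If m fits b i but not c (s i), the product is 0 anyway. *)
Lemma prod_lower_diag b c (s : 'S_l) i M : (b i < M)%N ->
  \sum_(1 <= m < M) (if (m <= b i)%N && (m <= c (s i))%N then
     \prod_p (lower b i m p == lower c (s i) m (s p))%:R else 0 : int)
  = (b i)%:R * \prod_p (b p == c (s p))%:R.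
Proof.
move=> ltM.
have E m : (m <= b i)%N ->
   (if (m <= b i)%N && (m <= c (s i))%N then
     \prod_p (lower b i m p == lower c (s i) m (s p))%:R else 0 : int)
   = \prod_p (b p == c (s p))%:R.
  move=> lem; rewrite lem /=; case: leqP => [lec|gtc].
    apply: eq_bigr => p _; rewrite /lower (inj_eq perm_inj).
    by case: (p =P i) => [->|//]; congr ((nat_of_bool _)%:R); lia.
  rewrite (bigD1 i) //=; have -> : (b i == c (s i)) = false by lia.
  by rewrite mul0r.
rewrite (big_cat_nat (n := (b i).+1)) //=.
rewrite [X in _ + X]big_nat_cond [X in _ + X]big1 => [|m /andP[/andP[lm _] _]]; last first.
  by have -> : (m <= b i)%N = false by lia.
rewrite addr0 big_nat_cond.
rewrite (eq_bigr (fun=> \prod_p (b p == c (s p))%:R)) => [|m /andP[/andP[_ lm] _]]; last first.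
  by rewrite E //; lia.
by rewrite -big_nat_cond sumr_const_nat -[LHS]mulr_natl subn1.
Qed.

(** A nonzero product forces m = b i - c (s i) = c (s p) - b p, so at most one m contributes. *)
Lemma prod_lower_off b c (s : 'S_l) i p M : p != i -> (b i < M)%N ->
  \sum_(1 <= m < M) (if (m <= b i)%N && (m <= c (s p))%N then
     \prod_q (lower b i m q == lower c (s p) m (s q))%:R else 0 : int)
  = (\prod_(q | (q != i) && (q != p)) (b q == c (s q))%:R) *
    ((b i + b p == c (s i) + c (s p))%N && (c (s i) < b i)%N)%:R.
Proof.
move=> npi ltM; set R := \prod_(q | _) _.
have E m : (if (m <= b i)%N && (m <= c (s p))%N then
     \prod_q (lower b i m q == lower c (s p) m (s q))%:R else 0 : int)
   = R * ([&& (m <= b i)%N, (m <= c (s p))%N, (b i - m == c (s i))%N & (b p == c (s p) - m)%N])%:R.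
  case: (m <= b i)%N; rewrite ?mulr0 //=; case: (m <= c (s p))%N; rewrite ?mulr0 //=.
  rewrite (bigD1 i) //= (bigD1 p) //= mulrA mulrC.
  congr (_ * _).
    apply: eq_bigr => q /andP[nqi nqp]; rewrite /lower (inj_eq perm_inj).
    by rewrite (negPf nqi) (negPf nqp).
  rewrite /lower !(inj_eq perm_inj) !eqxx (negPf npi) [i == p]eq_sym (negPf npi).
  by rewrite -natrM mulnb andbC.
rewrite (eq_bigr _ (fun m _ => E m)) -mulr_sumr; congr (_ * _).
case: andP => [[/eqP eqs ltc]|nE] /=.
  rewrite (bigD1_seq (b i - c (s i))%N) ?iota_uniq ?mem_index_iota /=; try lia.
  rewrite big1_seq ?addr0 => [|m /andP[nm]]; last first.
    by move=> _; rewrite [X in (nat_of_bool X)%:R](_ : _ = false) //; lia.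
  by rewrite [X in (nat_of_bool X)%:R](_ : _ = true) //; lia.
rewrite big1_seq // => m /andP[_]; rewrite mem_index_iota => lm.
by rewrite [X in (nat_of_bool X)%:R](_ : _ = false) //; lia.
Qed.

Definition swap_sum b c i p : int :=
  \sum_(s : 'S_l) (-1) ^+ s * ((\prod_(q | (q != i) && (q != p)) (b q == c (s q))%:R) *
    ((b i + b p == c (s i) + c (s p))%N && (c (s i) < b i)%N)%:R).

(** When b i + b p = c (s i) + c (s p), exactly one of c (s i) < b i and c (s p) < b p holds, unless
    s matches both indices exactly. The signed sum over all s with this equation is 0, because
    composing with the transposition of i and p keeps the equation and the other factors and flips
    the sign. What is left is minus the exact matches. *)
Lemma swap_sum_sym b c i p : p != i -> swap_sum b c i p + swap_sum b c p i = - match_det b c.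
Proof.
move=> npi; rewrite /swap_sum -big_split /= match_detE.
pose R (s : 'S_l) : int := \prod_(q | (q != i) && (q != p)) (b q == c (s q))%:R.
pose E (s : 'S_l) : bool := (b i + b p == c (s i) + c (s p))%N.
have zero : \sum_(s : 'S_l) (-1) ^+ s * (R s * (E s)%:R) = 0 :> int.
  set S := \sum_s _; suff: S = - S by move=> h; lia.
  rewrite {1}/S (reindex_inj (mulgI (tperm i p))) -sumrN; apply: eq_bigr => s _.
  rewrite odd_permM odd_tperm eq_sym npi signr_addb -[(-1) ^+ true]/(-1) mulN1r mulNr; congr (- (_ * (_ * _))).
    apply: eq_bigr => q /andP[nqi nqp]; rewrite permM tpermD // eq_sym //.
  by rewrite /E !permM tpermL tpermR [(c (s p) + _)%N]addnC.
rewrite -[RHS]add0r -[X in X + _](zero : _ = 0%R) -sumrB; apply: eq_bigr => s _.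
rewrite -mulrDr -mulrBr; congr (_ * _).
have -> : \prod_(q | (q != p) && (q != i)) (b q == c (s q))%:R = R s.
  by apply: eq_bigl => q; rewrite andbC.
rewrite -/(R s) -mulrDr (bigD1 i) //= (bigD1 p) //= [_ * R s]mulrC.
rewrite [_ * (R s * _)]mulrCA -mulrBr -natrM -natrD mulnb /E; apply: (congr1 (fun x => R s * x)).
rewrite [(b p + _)%N]addnC [(c (s p) + _)%N]addnC.
case: eqP => /= [e|ne]; last first.
  by rewrite [X in (nat_of_bool X)%:R](_ : _ = false) //; lia.
by case: (ltngtP (c (s i)) (b i)) => h1; case: (ltngtP (c (s p)) (b p)) => h2 //=; lia.
Qed.

(* In the Leibniz expansion the terms with j = s i contribute (sum b) * match_det b c;
   the others, paired by composing s with a transposition, contribute -match_det b c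
   for each pair {i, p}. *)
Lemma match_det_recursion b c n M : (forall i, b i < M)%N ->
  (\sum_i b i = n + 'C(l, 2))%N ->
  \sum_i \sum_j \sum_(1 <= m < M)
    (if (m <= b i)%N && (m <= c j)%N then match_det (lower b i m) (lower c j m) else 0)
  = n%:R * match_det b c.
Proof.
move=> ltM sumb.
pose G (s : 'S_l) i j : int := \sum_(1 <= m < M) (if (m <= b i)%N && (m <= c j)%N then
     \prod_q (lower b i m q == lower c j m (s q))%:R else 0).
transitivity (\sum_(s : 'S_l) (-1) ^+ s * \sum_i \sum_p G s i (s p)).
  transitivity (\sum_(s : 'S_l) (-1) ^+ s * \sum_i \sum_j G s i j); last first.
    by apply: eq_bigr => s _; congr (_ * _); apply: eq_bigr => i _; rewrite (reindex_inj (@perm_inj _ s)).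
  under [RHS]eq_bigr => s _ do rewrite mulr_sumr.
  rewrite [RHS]exchange_big /=; apply: eq_bigr => i _.
  under [RHS]eq_bigr => s _ do rewrite mulr_sumr.
  rewrite [RHS]exchange_big /=; apply: eq_bigr => j _.
  under [RHS]eq_bigr => s _ do rewrite mulr_sumr.
  rewrite [RHS]exchange_big /=; apply: eq_bigr => m _.
  case: ifP => _; first exact: match_detE.
  by rewrite big1 // => s _; rewrite mulr0.
transitivity (\sum_(s : 'S_l) ((-1) ^+ s * \sum_i (b i)%:R * \prod_p (b p == c (s p))%:R) +
   \sum_(i : 'I_l) \sum_(p | p != i) swap_sum b c i p).
  rewrite /swap_sum; under [X in _ + X]eq_bigr => i _ do rewrite exchange_big.
  rewrite [X in _ + X]exchange_big /= -big_split /=; apply: eq_bigr => s _.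
  rewrite mulr_sumr [X in X + _]mulr_sumr -big_split /=; apply: eq_bigr => i _.
  rewrite (bigD1 i) //= mulrDr {1}/G prod_lower_diag //; congr (_ + _).
  by rewrite mulr_sumr; apply: eq_bigr => p npi; rewrite /G prod_lower_off.
have H2 : (\sum_(i : 'I_l) \sum_(p | p != i) swap_sum b c i p) *+ 2 = - ((l * l.-1)%:R * match_det b c).
  rewrite mulr2n {1}(exchange_big_dep predT) //= -big_split /=.
  transitivity (\sum_(i : 'I_l) (- match_det b c *+ l.-1)).
    apply: eq_bigr => i _.
    under [X in X + _]eq_bigl => p do rewrite eq_sym.
    rewrite -big_split /=.
    under eq_bigr => p npi do rewrite addrC swap_sum_sym //.
    rewrite sumr_const (_ : #|_| = l.-1) //.
    by rewrite (eq_card (B := predC1 i)) ?cardC1 ?card_ord.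
  by rewrite sumr_const card_ord -mulrnA mulNrn -[in LHS]mulr_natl mulnC.
have -> : \sum_(s : 'S_l) ((-1) ^+ s * \sum_i (b i)%:R * \prod_p (b p == c (s p))%:R)
   = (n + 'C(l, 2))%:R * match_det b c :> int.
  rewrite match_detE mulr_sumr; apply: eq_bigr => s _.
  by rewrite -mulr_suml -natr_sum sumb mulrCA.
move: H2; have : ('C(l, 2) * 2 = l * l.-1)%N by rewrite bin2 muln2 -mul2n -[RHS]odd_double_half -mul2n; case: l => //= k; rewrite oddM /= andNb.
set D := match_det b c; set S := \sum_i _; move=> hC; rewrite -hC => h.
suff: S = - ('C(l, 2)%:R * D) by move=> ->; rewrite natrD mulrDl addrK.
have {}h : S + S = - ('C(l, 2)%:R * D + 'C(l, 2)%:R * D) by rewrite -mulr2n h natrM; ring.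
by move: h; set P := _%:R * D; lia.
Qed.

End MatchingDeterminant.

Lemma gtn_sorted_sum_ge (s : seq nat) : sorted gtn s ->
  ('C(size s, 2) + has (leq (size s)) s <= sumn s)%N.
Proof.
have tr : transitive gtn by move=> ? ? ? /= h1 h2; apply: ltn_trans h2 h1.
elim: s => //= x t IH p; have /= {}IH := IH (path_sorted p).
have /andP[/allP ltx ps] : all (gtn x) t && sorted gtn t by rewrite -path_sortedE.
have le : (size t <= x)%N.
  rewrite -(size_iota 0 x); apply: uniq_leq_size => [|y /ltx /=].
    by apply: sorted_uniq ps => //= ?; rewrite /= ltnn.
  by rewrite mem_iota.
rewrite binS bin1; case: hasP => [[y yt /= ley]|_]; last by rewrite orbF; lia.
by have := ltx y yt; rewrite /= orbT; lia.
Qed.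

Lemma uniq_sum_ge (s : seq nat) : uniq s ->
  ('C(size s, 2) + has (leq (size s)) s <= sumn s)%N.
Proof.
move=> us; have pe : perm_eq (sort geq s) s by rewrite perm_sort.
rewrite -(perm_has _ pe) -(perm_sumn pe) -(perm_size pe); apply: gtn_sorted_sum_ge.
by rewrite gtn_sorted_uniq_geq sort_uniq us sort_sorted // => x y; apply: leq_total.
Qed.

(** The extra 1 shows that distinct entries with the least possible sum are all below l, which
    settles degree 0 of Cauchy's identity. *)
Lemma sum_injective_ge l (b : 'I_l -> nat) : injective b ->
  ('C(l, 2) + [exists i, (l <= b i)%N] <= \sum_i b i)%N.
Proof.
move=> injb; have := @uniq_sum_ge (codom b); rewrite size_codom card_ord sumnE big_map big_enum /=.
move=> /(_ _)/(leq_trans _); apply; last exact/injectiveP.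
rewrite leq_add2l; case: existsP => //= -[i hi].
by have -> // : has (leq l) (codom b) by apply/hasP; exists (b i) => //; apply: codom_f.
Qed.

Section ShiftedDeterminants.
Variable l : nat.
Implicit Types b c al : 'I_l -> nat.

(** The coefficient of x^b in x^al times the Vandermonde determinant det(x_i^j). *)
Definition shift_det b al : int := \det (\matrix_(i, j) (b i == al i + j)%N%:R).

Lemma shift_det_add b al i0 m :
  shift_det b (fun i => (al i + m * (i == i0))%N) =
  if (m <= b i0)%N then shift_det (lower b i0 m) al else 0.
Proof.
case: leqP => [le|gt].
  congr (\det _); apply/matrixP => i j; rewrite !mxE /lower.
  by case: (eqVneq i i0) => [->|_]; rewrite ?muln1 ?muln0; congr ((nat_of_bool _)%:R); lia.
rewrite /shift_det (expand_det_row _ i0) big1 // => j _; rewrite mxE.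
by rewrite eqxx muln1 [X in (nat_of_bool X)%:R](_ : _ = false) ?mul0r //; lia.
Qed.

Lemma shift_det_eq b al al' : al =1 al' -> shift_det b al = shift_det b al'.
Proof. by move=> e; congr (\det _); apply/matrixP => i j; rewrite !mxE e. Qed.

Lemma match_det_eq0 b c i j : i != j -> b i = b j -> match_det b c = 0.
Proof. by move=> nij e; apply: (determinant_alternate nij) => k; rewrite !mxE e. Qed.

(** The matrices [b i = j] and [c k = j] multiply, after a transposition, to [b i = c k]; [b i < l]
    guarantees that the column b i exists. *)
Lemma shift_det_row0 b : (forall i, b i < l)%N -> forall c,
  shift_det b (fun=> 0%N) * shift_det c (fun=> 0%N) = match_det b c.
Proof.
move=> ltb c; rewrite /shift_det -[X in _ * X]det_tr -det_mulmx.
congr (\det _); apply/matrixP => i k; rewrite !mxE.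
rewrite (bigD1 (Ordinal (ltb i))) //= big1 => [|j nj]; rewrite !mxE add0n.
  by rewrite eqxx mul1r addr0 eq_sym.
rewrite [X in (nat_of_bool X)%:R](_ : _ = false) ?mul0r //.
by apply: contraNF nj => /eqP e; apply/eqP/val_inj.
Qed.

Lemma shift_det_ge b i : (l <= b i)%N -> shift_det b (fun=> 0%N) = 0.
Proof.
move=> ge; rewrite /shift_det (expand_det_row _ i) big1 // => j _; rewrite mxE.
by rewrite [X in (nat_of_bool X)%:R](_ : _ = false) ?mul0r //; have := ltn_ord j; lia.
Qed.

Section Recursion.
Variable N : nat.
Notation K := ('I_l * 'I_l)%type.
Implicit Types k : {ffun K -> 'I_N.+1}.

(* By [weighted_burnside], the inner product of the class functions [frob n b] and [frob n c]. *)
Definition content_sum n b c : int := \sum_(k : {ffun K -> 'I_N.+1} | (\sum_x k x == n)%N)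
  shift_det b (fun i => \sum_j k (i, j))%N * shift_det c (fun j => \sum_i k (i, j))%N.

Definition add_at k (x0 : K) (m : nat) : {ffun K -> 'I_N.+1} :=
  [ffun x => inord (k x + m * (x == x0))].
Definition sub_at k (x0 : K) (m : nat) : {ffun K -> 'I_N.+1} :=
  [ffun x => inord (k x - m * (x == x0))].

Lemma sum_unit (x0 : K) m : (\sum_x m * (x == x0) = m)%N.
Proof. by rewrite (bigD1 x0) //= eqxx muln1 big1 ?addn0 // => x /negPf->; rewrite muln0. Qed.

(** Adding m to the entry x0 is a bijection onto the matrices whose entry there is at least m, and
    [shift_det_add] moves the shift over to b and c. In generating functions this is multiplication
    by x_i^m y_j^m. *)
Lemma content_sum_bump n b c x0 m : (n <= N)%N -> (0 < m)%N ->
  \sum_(k : {ffun K -> 'I_N.+1} | (\sum_x k x == n)%N && (m <= k x0)%N)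
   shift_det b (fun i => \sum_j k (i, j))%N * shift_det c (fun j => \sum_i k (i, j))%N
  = if [&& (m <= n)%N, (m <= b x0.1)%N & (m <= c x0.2)%N]
    then content_sum (n - m)%N (lower b x0.1 m) (lower c x0.2 m) else 0.
Proof.
move=> leN m0.
have bound k x : (\sum_x k x <= n)%N -> (k x <= n)%N.
  by move=> h; apply: leq_trans h; rewrite (bigD1 x) //= leq_addr.
case: (leqP m n) => /= [lemn|ltnm]; last first.
  rewrite big1 // => k /andP[/eqP e h].
  by have := bound k x0; rewrite e => /(_ (leqnn _)); lia.
have bumpE k x : (\sum_x k x = n - m)%N -> (add_at k x0 m x = k x + m * (x == x0) :> nat)%N.
  move=> e; rewrite ffunE inordK //.
  have : (k x <= n - m)%N by rewrite -e (bigD1 x) //= leq_addr.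
  by case: (x == x0); lia.
rewrite (reindex_onto (fun k => add_at k x0 m) (fun k => sub_at k x0 m)) /=; last first.
  move=> k /andP[/eqP e h]; apply/ffunP => x; apply: val_inj; rewrite !ffunE.
  have := bound k x; rewrite e => /(_ (leqnn _)) h'.
  have le : (m * (x == x0) <= k x)%N by case: eqP => [->|]; rewrite ?muln1 ?muln0.
  by rewrite /= [(inord (k x - _) : nat)]inordK ?subnK ?inordK //; lia.
rewrite (eq_bigl (fun k : {ffun K -> 'I_N.+1} => (\sum_x k x == n - m)%N)); last first.
  move=> k; apply/idP/idP.
    case/andP=> /andP[/eqP e h] /eqP ek.
    have {}ek x : (k x = add_at k x0 m x - m * (x == x0) :> nat)%N.
      by rewrite -{1}ek ffunE inordK //; have := ltn_ord (add_at k x0 m x); lia.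
    under eq_bigr => x _ do rewrite ek.
    rewrite sumnB ?sum_unit ?e // => x _.
    by case: eqP => [->|]; rewrite ?muln1 ?muln0.
  move=> /eqP e; apply/andP; split; first (apply/andP; split).
  - under eq_bigr => x _ do rewrite (bumpE _ _ e).
    by rewrite big_split /= sum_unit e subnK.
  - by rewrite bumpE // eqxx muln1 leq_addl.
  apply/eqP/ffunP => x; apply: val_inj; rewrite ffunE bumpE // addnK /= inordK //.
have E k : (\sum_x k x == n - m)%N ->
   shift_det b (fun i => \sum_j add_at k x0 m (i, j))%N *
   shift_det c (fun j => \sum_i add_at k x0 m (i, j))%N =
   (if (m <= b x0.1)%N then shift_det (lower b x0.1 m) (fun i => \sum_j k (i, j))%N else 0) *
   (if (m <= c x0.2)%N then shift_det (lower c x0.2 m) (fun j => \sum_i k (i, j))%N else 0).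
  move=> /eqP e; rewrite -!shift_det_add; congr (_ * _); apply: shift_det_eq => i.
    under eq_bigr => j _ do rewrite bumpE //.
    rewrite big_split /=; congr (_ + _)%N; case: x0 {bumpE} => i0 j0 /=.
    rewrite (bigD1 j0) //= xpair_eqE eqxx andbT big1 ?addn0 // => j /negPf nj.
    by rewrite xpair_eqE nj andbF muln0.
  under eq_bigr => j _ do rewrite bumpE //.
  rewrite big_split /=; congr (_ + _)%N; case: x0 {bumpE} => i0 j0 /=.
  rewrite (bigD1 i0) //= xpair_eqE eqxx /= big1 ?addn0 // => j /negPf nj.
  by rewrite xpair_eqE nj muln0.
rewrite (eq_bigr _ E); case: (m <= b x0.1)%N; case: (m <= c x0.2)%N => //=;
  by rewrite big1 // => k _; rewrite ?mul0r ?mulr0.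
Qed.

(** Newton's recursion n h_n = sum_m p_m h_(n-m) in the variables x_i y_j: n is the sum of the
    entries k x, and k x counts the m with 1 <= m <= k x. *)
Lemma content_sum_recursion n b c : (n <= N)%N ->
  n%:R * content_sum n b c = \sum_i \sum_j \sum_(1 <= m < N.+1)
   if [&& (m <= n)%N, (m <= b i)%N & (m <= c j)%N]
   then content_sum (n - m)%N (lower b i m) (lower c j m) else 0.
Proof.
move=> leN.
rewrite pair_bigA /=.
transitivity (\sum_(x : K) \sum_(1 <= m < N.+1) \sum_(k : {ffun K -> 'I_N.+1} | (\sum_x k x == n)%N && (m <= k x)%N)
   shift_det b (fun i => \sum_j k (i, j))%N * shift_det c (fun j => \sum_i k (i, j))%N); last first.
  apply: eq_bigr => x _; rewrite !big_nat; apply: eq_bigr => m /andP[m0 _].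
  by rewrite content_sum_bump.
under eq_bigr => x _ do under eq_bigr => m _ do rewrite big_mkcondr.
under eq_bigr => x _ do rewrite exchange_big /=.
rewrite exchange_big /content_sum mulr_sumr /=; apply: eq_bigr => k /eqP e.
set T := shift_det _ _ * _; rewrite -e natr_sum mulr_suml; apply: eq_bigr => x _.
have lek := ltn_ord (k x).
rewrite (big_cat_nat (n := (k x).+1)) //=.
rewrite [X in _ + X]big_nat [X in _ + X]big1 => [|m lm]; last first.
  by have -> : (m <= k x)%N = false by lia.
rewrite addr0 big_nat (eq_bigr (fun=> T)) => [|m lm]; last first.
  by have -> : (m <= k x)%N by lia.
by rewrite -big_nat sumr_const_nat subn1 mulr_natl.
Qed.

Lemma match_det_not_inj b c : ~ injective b -> match_det b c = 0.
Proof.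
move=> ninj; have /injectivePn[i [j nij e]] : ~~ injectiveb b by apply/negP => /injectiveP.
exact: match_det_eq0 nij e.
Qed.

Lemma match_det_small b c : (\sum_i b i < 'C(l, 2))%N -> match_det b c = 0.
Proof.
by move=> lt; apply: match_det_not_inj => /sum_injective_ge; lia.
Qed.

Lemma sum_lower b i m : (m <= b i)%N -> (\sum_k lower b i m k = \sum_k b k - m)%N.
Proof.
move=> le; rewrite (bigD1 i) //= [in RHS](bigD1 i) //= {1}/lower eqxx.
rewrite (eq_bigr b) => [|k /negPf nk]; last by rewrite /lower nk.
by rewrite addnBAC.
Qed.

(** Cauchy's identity in degree n: both sides satisfy the same recursion, [content_sum_recursion]
    and [match_det_recursion], and agree in degree 0. *)
Lemma content_sumE n b c : (n + 'C(l, 2) <= N)%N ->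
  (\sum_i b i = n + 'C(l, 2))%N -> (\sum_i c i = n + 'C(l, 2))%N ->
  content_sum n b c = match_det b c.
Proof.
elim/ltn_ind: n b c => n IH b c leN sb sc.
have [n0|n_gt0] := posnP n.
  rewrite n0 /content_sum (big_pred1 [ffun=> ord0]) => [|k]; last first.
    rewrite sum_nat_eq0; apply/forallP/eqP => [h|-> x]; last by rewrite ffunE.
    by apply/ffunP => x; apply: val_inj; rewrite ffunE; apply/eqP/h.
  transitivity (shift_det b (fun=> 0%N) * shift_det c (fun=> 0%N)).
    by congr (_ * _); apply: shift_det_eq => i; rewrite big1 // => j _; rewrite ffunE.
  have [/forallP /= hb|/forallPn /= [i hi]] := boolP [forall i, (b i < l)%N].
    exact: shift_det_row0.
  (* The entries of b have the minimal sum C(l, 2) and one of them is at least l, so they are not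
     distinct. *)
  rewrite -leqNgt in hi; rewrite (shift_det_ge hi) mul0r match_det_not_inj // => /sum_injective_ge.
  by rewrite (_ : [exists i, _]) ?sb ?n0; [lia | apply/existsP; exists i].
have hb i : (b i < N.+1)%N by rewrite ltnS (leq_trans _ leN) // -sb (bigD1 i) //= leq_addr.
apply: (mulfI (_ : n%:R != 0 :> int)); first by lia.
rewrite content_sum_recursion; last by apply: leq_trans leN; apply: leq_addr.
rewrite -(match_det_recursion c hb sb).
apply: eq_bigr => i _; apply: eq_bigr => j _; rewrite !big_nat; apply: eq_bigr => m /andP[m0 _].
case: (leqP m (b i)) => [lb|]; last by rewrite andbF.
case: (leqP m (c j)) => [lc|]; last by rewrite !andbF.
case: (leqP m n) => [ln|ltn] /=.
  by rewrite IH ?sum_lower ?sb ?sc //; lia.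
(* For m > n the lowered entries sum to less than C(l, 2), so two of them coincide. *)
rewrite match_det_small // sum_lower // sb ltn_subLR; last by rewrite -sb (bigD1 i) //= (leq_trans lb) ?leq_addr.
by rewrite ltn_add2r.
Qed.

End Recursion.
End ShiftedDeterminants.

(** * Permutation characters on colorings and orbit counting *)

Section PermutationCharacter.
Variables (gT : finGroupType) (G : {group gT}) (T : finType) (to : T -> gT -> T).
Hypothesis to1 : forall x, to x 1%g = x.
Hypothesis toM : forall x g h, to x (g * h)%g = to (to x g) h.
Variable S : {set T}.
Hypothesis toS : forall x g, x \in S -> to x g \in S.

Definition perm_repr_mx g : 'M[algC]_#|S| :=
  \matrix_(i, j) (to (enum_val i) g == enum_val j)%:R.

Lemma perm_repr_mxP : mx_repr G perm_repr_mx.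
Proof.
split=> [|g h _ _]; apply/matrixP => i j; rewrite !mxE.
  by rewrite to1 (inj_eq enum_val_inj).
have Sg := toS g (enum_valP i).
rewrite (bigD1 (enum_rank_in Sg (to (enum_val i) g))) //= !mxE.
rewrite enum_rankK_in // eqxx mul1r -toM big1 ?addr0 // => k nk; rewrite mxE.
case: eqP => [e|]; last by rewrite mul0r.
by case/eqP: nk; apply: enum_val_inj; rewrite -e enum_rankK_in.
Qed.

Definition perm_repr := MxRepresentation perm_repr_mxP.

Lemma perm_reprE g : g \in G -> cfRepr perm_repr g = #|[set x in S | to x g == x]|%:R.
Proof.
move=> Gg; rewrite cfunE Gg mulr1n /mxtrace.
rewrite -[X in _ = X%:R]sum1_card natr_sum (eq_bigl (fun x => (x \in S) && (to x g == x))); last by move=> x; rewrite inE.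
rewrite big_mkcondr [RHS]big_enum_val /=; apply: eq_bigr => i _; rewrite mxE.
by case: eqP.
Qed.
End PermutationCharacter.

Section Colorings.
Variables (n : nat) (K : finType).
Implicit Types d : {ffun 'I_n -> K}.

(** The inverse makes this a right action, since products of permutations are read from left to
    right. *)
Definition recolor d (g : 'S_n) : {ffun 'I_n -> K} := [ffun x => d (g^-1%g x)].

Definition content d k := #|[set x | d x == k]|.

Lemma recolor1 d : recolor d 1%g = d.
Proof. by apply/ffunP => x; rewrite ffunE invg1 perm1. Qed.

Lemma recolorM d g h : recolor d (g * h)%g = recolor (recolor d g) h.
Proof. by apply/ffunP => x; rewrite !ffunE invMg permM. Qed.

Lemma content_recolor d g : content (recolor d g) =1 content d.
Proof.
move=> k; rewrite /content -[RHS](card_imset _ (@perm_inj _ g)); apply: eq_card => x.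
rewrite !inE ffunE; apply/idP/imsetP => [h|[y]]; last by rewrite inE => h ->; rewrite permK.
by exists (g^-1%g x); rewrite ?inE ?permKV.
Qed.

Definition color_inv (g : 'S_n) d := [forall x, d (g x) == d x].

Lemma recolor_fix d g : (recolor d g == d) = color_inv g d.
Proof.
apply/eqP/forallP => [e x|h].
  by rewrite -{1}e ffunE permK.
by apply/ffunP => x; rewrite ffunE -(eqP (h _)) permKV.
Qed.

Lemma sum_content d : (\sum_k content d k = n)%N.
Proof.
rewrite -[RHS]card_ord -sum1_card (partition_big d predT) //=; apply: eq_bigr => k _.
by rewrite sum1_card; apply: eq_card => x; rewrite !inE.
Qed.

Lemma content_count d k : content d k = count_mem k [seq d i | i <- enum 'I_n].
Proof.
rewrite -sum1_count big_map /= big_enum_cond /= sum1_card /content.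
by apply: eq_card => x; rewrite !inE.
Qed.

Lemma content_exists (a : K -> nat) : (\sum_k a k = n)%N -> exists d, content d =1 a.
Proof.
move=> sa; pose s := flatten [seq nseq (a k) k | k <- enum K].
have /eqP ss : size s = n.
  rewrite size_flatten sumnE !big_map -sa -enumT big_enum /=.
  by apply: eq_bigr => k _; rewrite size_nseq.
exists [ffun i => tnth (Tuple ss) i] => k; rewrite content_count.
rewrite (eq_map (g := tnth (Tuple ss))) => [|i]; last by rewrite ffunE.
rewrite map_tnth_enum /=.
rewrite count_flatten sumnE !big_map -enumT big_enum /= (bigD1 k) //= big1 ?addn0 => [|j /negPf nj].
  by rewrite count_nseq /= eqxx mul1n.
by rewrite count_nseq /= nj mul0n.
Qed.

Lemma same_content_perm d d' : content d =1 content d' ->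
  exists p : 'S_n, forall x, d' (p x) = d x.
Proof.
move=> e; have pe : perm_eq [tuple d i | i < n] [tuple d' i | i < n].
  by apply/allP => k _; move: (e k); rewrite !content_count /= => ->.
case/tuple_permP: pe => p ep; exists p => x.
have : [tuple d i | i < n] = [tuple tnth [tuple d' i | i < n] (p i) | i < n] by apply: val_inj.
by move=> /(congr1 (fun t => tnth t x)); rewrite !tnth_mktuple.
Qed.

(* Both sides count the permutations p with d0 p = d for some d of the given content. *)
Lemma sum_stabilizers (a : K -> nat) : (\sum_k a k = n)%N ->
  (\sum_(d | [forall k, content d k == a k]) #|[set g | color_inv g d]| = n`!)%N.
Proof.
move=> sa; have [d0 c0] := content_exists sa.
pose pull (p : 'S_n) := [ffun x => d0 (p x)].
have cp p : content (pull p) =1 a.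
  move=> k; rewrite -c0 /content -[LHS](card_imset _ (@perm_inj _ p)); apply: eq_card => x.
  rewrite !inE; apply/imsetP/idP => [[y]|h]; first by rewrite inE ffunE => h ->.
  by exists (p^-1%g x); rewrite ?inE ?ffunE permKV.
rewrite -[in RHS](card_Sn n) -sum1_card (partition_big pull (fun d => [forall k, content d k == a k])) /=; last first.
  by move=> p _; apply/forallP => k; rewrite cp.
apply: eq_bigr => d /forallP cd; rewrite sum1_card.
have [p0 hp0] : exists p : 'S_n, forall x, d0 (p x) = d x.
  by apply: same_content_perm => k; rewrite c0 (eqP (cd k)).
rewrite -[LHS](card_imset _ (@mulIg _ p0)); apply: eq_card => p.
rewrite [RHS](_ : _ = (pull p == d)) //; apply/imsetP/eqP => [[g]|e].
  rewrite inE => /forallP ig ->; apply/ffunP => x.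
  by rewrite ffunE permM hp0 (eqP (ig x)).
exists (p * p0^-1)%g; rewrite ?mulgKV // inE; apply/forallP => x.
by rewrite permM -hp0 permKV -[d x]/((fun d => d x) d) -e ffunE.
Qed.

Variable N : nat.
Hypothesis leN : (n <= N)%N.

Definition contentN d : {ffun K -> 'I_N.+1} := [ffun k => inord (content d k)].

Lemma contentNE d k : contentN d k = content d k :> nat.
Proof.
by rewrite ffunE inordK // ltnS (leq_trans _ leN) // -(sum_content d) (bigD1 k) //= leq_addr.
Qed.
End Colorings.

(** Double counting of the pairs (g, d) with d invariant under g: by [sum_stabilizers] every content
    accounts for n! of them. *)
Lemma weighted_burnside n (K : finType) N (h : {ffun K -> 'I_N.+1} -> int) : (n <= N)%N ->
  \sum_(g : 'S_n) \sum_(d : {ffun 'I_n -> K} | color_inv g d) h (contentN N d) =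
  (n`!)%:R * \sum_(k : {ffun K -> 'I_N.+1} | (\sum_x k x == n)%N) h k.
Proof.
move=> leN; rewrite (exchange_big_dep predT) //=.
rewrite (partition_big (contentN N) (fun k : {ffun K -> 'I_N.+1} => (\sum_x k x == n)%N)) /=; last first.
  by move=> d _; under eq_bigr => x _ do rewrite contentNE //; rewrite sum_content.
rewrite mulr_sumr; apply: eq_bigr => k /eqP sk.
rewrite -(sum_stabilizers sk) natr_sum mulr_suml.
apply: eq_big => [d|d /eqP <-].
  apply/eqP/forallP => [<- x|h']; first by rewrite contentNE.
  by apply/ffunP => x; apply: val_inj; rewrite /= contentNE //; apply/eqP.
by rewrite sumr_const mulr_natl; congr (_ *+ _); apply: eq_card => g; rewrite inE.
Qed.

(** * Frobenius characters: orthonormality and completeness *)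

Section FrobeniusCharacters.
Variables n l : nat.
Implicit Types b c : 'I_l -> nat.

Definition coloring_set (al : {ffun 'I_l -> 'I_n.+1}) : {set {ffun 'I_n -> 'I_l}} :=
  [set d | contentN n d == al].

Lemma recolor_coloring_set al d g :
  d \in coloring_set al -> recolor d g \in coloring_set al.
Proof.
rewrite !inE => /eqP <-; apply/eqP/ffunP => k; rewrite !ffunE.
by rewrite (content_recolor d g k).
Qed.

Definition coloring_char al : 'CF(SymG n) :=
  cfRepr (perm_repr (SymG n) (@recolor1 n _) (@recolorM n _) (@recolor_coloring_set al)).

Lemma coloring_charE al g :
  coloring_char al g = #|[set d in coloring_set al | color_inv g d]|%:R.
Proof.
rewrite perm_reprE ?inE //; congr (_%:R); apply: eq_card => d.
by rewrite !inE recolor_fix.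
Qed.

(** By the Leibniz formula only the al with al_i = b_i - s_i, s a permutation of 0, ..., l - 1,
    contribute: this is the Jacobi-Trudi determinant det(h_(b_i - j)), with h_al read as the
    character on colorings of content al. *)
Definition frob b : 'CF(SymG n) :=
  \sum_(al : {ffun 'I_l -> 'I_n.+1}) (shift_det b (fun i => al i : nat))%:~R *: coloring_char al.

(** Frobenius' formula: the invariant colorings expand the product of the power sums of the cycle
    lengths of g, and the value is the coefficient of x^b in this product times the Vandermonde
    determinant. *)
Lemma frobE b g :
  frob b g = (\sum_(d : {ffun 'I_n -> 'I_l} | color_inv g d) shift_det b (content d))%:~R.
Proof.
rewrite sum_cfunE [in RHS](partition_big (contentN n) predT) //= [RHS]rmorph_sum.
apply: eq_bigr => al _. rewrite cfunE coloring_charE -[X in _ * X]mulrz_nat -rmorphM /=; congr (_%:~R).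
rewrite -sum1_card natr_sum mulr_sumr.
rewrite (eq_bigl (fun d => color_inv g d && (contentN n d == al))) => [|d]; last by rewrite !inE andbC.
apply: eq_bigr => d /andP[_ /eqP <-]; rewrite mulr1; apply: shift_det_eq => i.
by rewrite contentNE.
Qed.

Lemma frob_vchar b : frob b \in 'Z[irr (SymG n)].
Proof.
apply: rpred_sum => al _; rewrite scaler_int rpredMz // char_vchar //.
exact: cfRepr_char.
Qed.

(** Two invariant colorings form one invariant coloring with colors in ['I_l * 'I_l], so
    [weighted_burnside] turns the inner product into [content_sum]. *)
Lemma frob_dot b c :
  (\sum_i b i = n + 'C(l, 2))%N -> (\sum_i c i = n + 'C(l, 2))%N ->
  '[frob b, frob c] = (match_det b c)%:~R.
Proof.
move=> sb sc; pose N := (n + 'C(l, 2))%N.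
have leN : (n <= N)%N by apply: leq_addr.
rewrite cfdotE cardsT card_Sn -(content_sumE (leqnn N)) //.
apply: (mulfI (_ : n`!%:R != 0 :> algC)); first by rewrite pnatr_eq0 -lt0n fact_gt0.
rewrite mulVKf ?pnatr_eq0 -?lt0n ?fact_gt0 // -[X in X * _]mulrz_nat -rmorphM /=.
pose h (k : {ffun ('I_l * 'I_l) -> 'I_N.+1}) := shift_det b (fun i => \sum_j k (i, j))%N *
  shift_det c (fun j => \sum_i k (i, j))%N.
have := weighted_burnside h leN; rewrite /content_sum -/N => <-.
rewrite rmorph_sum (eq_bigl predT) => [|g]; last by rewrite inE.
apply: eq_bigr => g _; rewrite !frobE rmorph_int -rmorphM; congr (_%:~R).
rewrite big_distrlr pair_big /=.
rewrite (reindex (fun d : {ffun 'I_n -> 'I_l * 'I_l} => ([ffun x => (d x).1], [ffun x => (d x).2]))) /=; last first.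
  exists (fun p : {ffun 'I_n -> 'I_l} * {ffun 'I_n -> 'I_l} => [ffun x => (p.1 x, p.2 x)]) => [d|[p q]] _; first by apply/ffunP => x; rewrite !ffunE; case: (d x).
  by congr pair; apply/ffunP => x; rewrite !ffunE.
apply: eq_big => [d|d _].
  apply/andP/forallP => [[/forallP h1 /forallP h2] x|h1].
    move: (h1 x) (h2 x); rewrite !ffunE => /eqP e1 /eqP e2.
    by rewrite -pair_eqE /= e1 e2 !eqxx.
  by split; apply/forallP => x; rewrite !ffunE (eqP (h1 x)).
rewrite /h; congr (_ * _); apply: shift_det_eq => i.
  under eq_bigr => j _ do rewrite contentNE //.
  rewrite /content -sum1_card (partition_big (fun x => (d x).2) predT) //=.
  apply: eq_bigr => j _; rewrite sum1_card; apply: eq_card => x.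
  by rewrite [RHS]inE -[LHS]topredE /= !inE ffunE -pair_eqE.
under eq_bigr => j _ do rewrite contentNE //.
rewrite /content -sum1_card (partition_big (fun x => (d x).1) predT) //=.
apply: eq_bigr => j _; rewrite sum1_card; apply: eq_card => x.
by rewrite [RHS]inE -[LHS]topredE /= !inE ffunE -pair_eqE andbC.
Qed.

End FrobeniusCharacters.

Lemma match_det_inj l (b : 'I_l -> nat) : injective b -> match_det b b = 1.
Proof.
move=> injb; rewrite /match_det -[RHS](det1 _ l); congr (\det _).
by apply/matrixP => i j; rewrite !mxE (inj_eq injb).
Qed.

Lemma shift_det_diag l (al : 'I_l -> nat) : shift_det (fun i => al i + i)%N al = 1.
Proof.
rewrite /shift_det -[RHS](det1 _ l); congr (\det _).
by apply/matrixP => i j; rewrite !mxE eqn_add2l.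
Qed.

Lemma shift_det_neq0 l (b al : 'I_l -> nat) : shift_det b al != 0 ->
  exists s : 'S_l, forall i, b i = (al i + s i)%N.
Proof.
move=> nz; have [/existsP[s /forallP h]|] := boolP [exists s : 'S_l, forall i, b i == (al i + s i)%N].
  by exists s => i; apply/eqP.
rewrite negb_exists => /forallP h; case/eqP: nz.
rewrite /shift_det /determinant big1 // => s _.
have /forallPn[i /negPf hi] := h s.
by rewrite (bigD1 i) //= mxE hi mul0r mulr0.
Qed.

(* Rearrangement inequality, via [2 sum i^2 - 2 sum i s(i) = sum (i - s i)^2]. *)
Lemma rearrangement_ord l (s : 'S_l) :
  (\sum_(i < l) i * i <= \sum_(i < l) i * s i)%N -> forall i, s i = i.
Proof.
move=> le i; apply/val_inj/esym/eqP.
have H : \sum_(j < l) ((j : nat)%:R - (s j : nat)%:R) ^+ 2 <= 0 :> int.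
  have -> : \sum_(j < l) ((j : nat)%:R - (s j : nat)%:R) ^+ 2 =
    ((\sum_(j < l) j * j)%N%:R - (\sum_(j < l) j * s j)%N%:R) *+ 2 :> int.
    rewrite mulr2n; set P := (X in X%:R - _); set Q := (X in _ - X%:R).
    have -> : P%:R - Q%:R + (P%:R - Q%:R) = P%:R - Q%:R *+ 2 + (\sum_(j < l) s j * s j)%N%:R :> int.
      have <- : P = (\sum_(j < l) s j * s j)%N by rewrite /P (reindex_inj (@perm_inj _ s)).
      ring.
    rewrite !natr_sum mulr2n opprD -!sumrN -!big_split /=; apply: eq_bigr => j _.
    rewrite !natrM; ring.
  by lia.
have: ((i : nat)%:R - (s i : nat)%:R) ^+ 2 <= 0 :> int.
  apply: le_trans H; rewrite (bigD1 i) //= lerDl; apply: sumr_ge0 => j _; exact: sqr_ge0.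
by rewrite exprn_even_le0 //= subr_eq0 eqr_nat.
Qed.

Lemma sum_ord_id n : (\sum_(i < n) i = 'C(n, 2))%N.
Proof. by rewrite -bin2_sum big_mkord. Qed.

Section Completeness.
Variables (n : nat) (i : Iirr (SymG n)).

Let al1 : {ffun 'I_n -> 'I_n.+1} := [ffun=> inord 1].

(** Colorings with n distinct colors have trivial stabilizers, so this character is regular and
    contains every irreducible one. *)
Lemma coloring_char_regular : '[coloring_char al1, 'chi_i] != 0.
Proof.
have al1E k : al1 k = 1%N :> nat.
  by rewrite ffunE inordK // ltnS; case: k => k; case: (n).
have z g : g != 1%g -> coloring_char al1 g = 0.
  move=> ng; rewrite coloring_charE eq_card0 // => d; apply/negbTE/negP; rewrite !inE.
  case/andP=> /eqP e /forallP h; case/eqP: ng; apply/permP => x; rewrite perm1.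
  have : content d (d x) = 1%N by rewrite -(contentNE (leqnn n)) e al1E.
  rewrite /content => /eqP/cards1P[y ey].
  have : g x \in [set y] by rewrite -ey inE.
  have : x \in [set y] by rewrite -ey inE.
  by rewrite !inE => /eqP -> /eqP ->.
have nz : coloring_char al1 1%g != 0.
  rewrite coloring_charE pnatr_eq0 -lt0n; apply/card_gt0P; exists [ffun x => x].
  rewrite !inE; apply/andP; split; last by apply/forallP => x; rewrite !ffunE perm1.
  apply/eqP/ffunP => x; apply: val_inj; rewrite /= contentNE // al1E.
  rewrite /content -(cards1 x); apply: eq_card => y; by rewrite !inE ffunE.
rewrite cfdotE (bigD1 1%g) ?inE //= big1 => [|g /andP[_ ng]]; last by rewrite z ?mul0r.
rewrite addr0 !mulf_neq0 ?invr_neq0 ?neq0CG ?conjC_eq0 //; exact: irr1_neq0.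
Qed.

(** Take al with the largest sum of k al_k among the contents whose coloring character contains chi,
    and b_k = al_k + k. Every other content in the expansion of [frob n b] is al_k + k - s_k, whose
    sum is strictly larger by the rearrangement inequality, so chi does not occur there. Hence
    [frob n b] has a nonzero inner product with chi; its norm is 0 or 1, so it is chi up to sign. *)
Lemma irr_frob : exists2 b : 'I_n -> nat, injective b /\ (\sum_k b k = n + 'C(n, 2))%N &
  exists e : bool, 'chi_i = (-1) ^+ e *: frob n b.
Proof.
pose A (al : {ffun 'I_n -> 'I_n.+1}) := '[coloring_char al, 'chi_i].
have [al nzA maxA] := @arg_maxnP _ al1 (fun al => A al != 0) (fun a : {ffun 'I_n -> 'I_n.+1} => \sum_(k < n) k * a k)%N coloring_char_regular.
pose b (k : 'I_n) := (al k + k)%N.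
have sal : (\sum_k al k = n)%N.
  have [d] : exists d : {ffun 'I_n -> 'I_n}, d \in coloring_set al.
    have [e0|[d hd]] := set_0Vmem (coloring_set al); last by exists d.
    case/eqP: nzA; rewrite /A cfdotE big1 ?mulr0 // => g _.
    rewrite coloring_charE eq_card0 ?mul0r // => d.
    by rewrite inE e0 inE.
  rewrite inE => /eqP <-; under eq_bigr => k _ do rewrite contentNE //.
  exact: sum_content.
have sb : (\sum_k b k = n + 'C(n, 2))%N by rewrite big_split /= sal sum_ord_id.
have dotA : '[frob n b, 'chi_i] = A al.
  rewrite cfdot_suml (bigD1 al) //= cfdotZl shift_det_diag mul1r big1 ?addr0 // => al' nal.
  rewrite cfdotZl -/(A al'); have [->|nz'] := eqVneq (A al') 0; first by rewrite mulr0.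
  have [->|nzd] := eqVneq (shift_det b (fun i => al' i : nat)) 0; first by rewrite mul0r.
  have [s hs] := shift_det_neq0 nzd; case/eqP: nal.
  have sid : forall k, s k = k.
    apply: rearrangement_ord; have := maxA al' nz'.
    have : (\sum_(k < n) k * b k = \sum_(k < n) k * (al' k + s k))%N by apply: eq_bigr => k _; rewrite hs.
    rewrite /b; under eq_bigr => k _ do rewrite mulnDr.
    under [X in _ = X -> _]eq_bigr => k _ do rewrite mulnDr.
    by rewrite !big_split /=; lia.
  apply/ffunP => k; apply: val_inj; have := hs k; rewrite /b sid /=; lia.
have injb : injective b.
  apply/injectiveP; apply: contraNT nzA => ninj.
  have : '[frob n b] = 0 by rewrite frob_dot // match_det_not_inj // => /injectiveP; apply/negP.
  by move/eqP; rewrite cfnorm_eq0 => /eqP f0; rewrite -/(A al) -dotA f0 cfdot0l.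
exists b; first by split.
have [|e [j ej]] := vchar_norm1P (frob_vchar n b); first by rewrite frob_dot // match_det_inj.
exists e; rewrite ej scalerA -signr_addb addbb expr0 scale1r.
move: nzA; rewrite -/(A al) -dotA ej cfdotZl cfdot_irr; case: (eqVneq j i) => [-> //|_].
by rewrite mulr0 eqxx.
Qed.
End Completeness.

(** * Character values on a cycle type *)

Fixpoint mnv l (b : 'I_l -> nat) (s : seq nat) : int :=
  if s is m :: s' then \sum_i (if (m <= b i)%N then mnv (lower b i m) s' else 0)
  else shift_det b (fun=> 0%N).

Lemma sum_ffun_recl k (T : finType) (F : {ffun 'I_k.+1 -> T} -> int) :
  \sum_e F e = \sum_i \sum_(e : {ffun 'I_k -> T})
     F [ffun t => if unlift ord0 t is Some t' then e t' else i].
Proof.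
rewrite pair_bigA /=.
rewrite (reindex (fun p : T * {ffun 'I_k -> T} => [ffun t => if unlift ord0 t is Some t' then p.2 t' else p.1])) //.
exists (fun e : {ffun 'I_k.+1 -> T} => (e ord0, [ffun t => e (lift ord0 t)])) => [[i e]|e] _ /=.
  rewrite ffunE unlift_none; congr pair.
  by apply/ffunP => t; rewrite !ffunE liftK.
by apply/ffunP => t; rewrite ffunE; case: unliftP => [t'|] ->; rewrite ?ffunE.
Qed.

(** The recursion chooses a color e t for each cycle t and subtracts the length of the cycle from
    the exponent of that color. *)
Lemma mnvE l (b : 'I_l -> nat) s :
  \sum_(e : {ffun 'I_(size s) -> 'I_l})
    shift_det b (fun i => \sum_(t < size s) nth 0 s t * (e t == i))%N = mnv b s.
Proof.
elim: s b => [|m s IH] b /=.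
  rewrite (big_pred1 [ffun t : 'I_0 => widen_ord (leq0n l) t]) /=; last first.
    by move=> e; apply/esym/eqP/ffunP => -[].
  by apply: shift_det_eq => i; rewrite big_ord0.
rewrite sum_ffun_recl; apply: eq_bigr => i _.
transitivity (\sum_(e : {ffun 'I_(size s) -> 'I_l})
   if (m <= b i)%N then shift_det (lower b i m) (fun j => \sum_(t < size s) nth 0 s t * (e t == j))%N else 0); last first.
  by case: ifP => _; rewrite ?IH // big1.
apply: eq_bigr => e _; rewrite -shift_det_add; apply: shift_det_eq => j.
rewrite big_ord_recl /= ffunE unlift_none addnC eq_sym; congr (_ + _)%N.
by apply: eq_bigr => t _; rewrite ffunE liftK.
Qed.

(** B sends a point to the index of its cycle and r picks a point on each cycle. The last clause
    says that the fibres of B are single orbits, in the form that counting invariant colorings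
    requires. *)
Definition has_cycle_type n (g : 'S_n) (s : seq nat) :=
  exists (B : 'I_n -> 'I_(size s)) (r : 'I_(size s) -> 'I_n),
  [/\ forall x, B (g x) = B x, cancel r B,
      forall t, #|[set x | B x == t]| = nth 0%N s t &
      forall (T : finType) (d : {ffun 'I_n -> T}), color_inv g d -> forall x, d x = d (r (B x))].

Lemma sum_color_inv n (g : 'S_n) s l (F : {ffun 'I_n -> 'I_l} -> int) (H : has_cycle_type g s) :
  exists2 B : 'I_n -> 'I_(size s), (forall t, #|[set x | B x == t]| = nth 0%N s t) &
  \sum_(d | color_inv g d) F d = \sum_(e : {ffun 'I_(size s) -> 'I_l}) F [ffun x => e (B x)].
Proof.
case: H => B [r [Bg rK cB inv]]; exists B => //.
rewrite (reindex_onto (fun e : {ffun 'I_(size s) -> 'I_l} => [ffun x => e (B x)])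
  (fun d : {ffun 'I_n -> 'I_l} => [ffun t => d (r t)])) /=; last first.
  by move=> d /inv h; apply/ffunP => x; rewrite !ffunE -h.
apply: eq_bigl => e; apply/andP; split; first by apply/forallP => x; rewrite !ffunE Bg.
by apply/eqP/ffunP => t; rewrite !ffunE rK.
Qed.

Lemma frob_mnv n (g : 'S_n) s l (b : 'I_l -> nat) :
  has_cycle_type g s -> frob n b g = (mnv b s)%:~R.
Proof.
move=> H; rewrite frobE; congr (_%:~R).
have [B cB ->] := sum_color_inv (fun d => shift_det b (content d)) H.
rewrite -mnvE; apply: eq_bigr => e _; apply: shift_det_eq => i.
rewrite /content -sum1_card (partition_big B predT) //=; apply: eq_bigr => t _.
rewrite -cB -sum1_card; case: (eqVneq (e t) i) => [et|/negPf net].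
  rewrite muln1; apply: eq_bigl => x; rewrite !inE ffunE.
  by case: (eqVneq (B x) t) => [->|]; rewrite ?et ?eqxx ?andbF.
rewrite muln0 big1 // => x /andP[]; rewrite inE ffunE => /eqP e1 /eqP e2.
by rewrite -e2 e1 eqxx in net.
Qed.

Lemma color_inv_porbit n (g : 'S_n) (T : finType) (d : {ffun 'I_n -> T}) x y :
  color_inv g d -> y \in porbit g x -> d y = d x.
Proof.
move=> /forallP h /porbitP[i ->]; elim: i => [|i IH]; first by rewrite expg0 perm1.
by rewrite expgSr permM (eqP (h _)).
Qed.

Lemma cycle_type_exists n (g : 'S_n) : exists s, has_cycle_type g s.
Proof.
pose O : seq {set 'I_n} := enum (porbits g); exists (map (fun o : {set 'I_n} => #|o|) O).
have so : size (map (fun o : {set 'I_n} => #|o|) O) = size O by rewrite size_map.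
have memO x : porbit g x \in O by rewrite mem_enum imset_f.
have ltB x : (index (porbit g x) O < size (map (fun o : {set 'I_n} => #|o|) O))%N by rewrite so index_mem.
pose B x := Ordinal (ltB x).
have [r hr] : exists r : 'I_(size (map (fun o : {set 'I_n} => #|o|) O)) -> 'I_n,
    forall t, porbit g (r t) = nth set0 O t.
  apply: (@fin_all_exists _ (fun=> 'I_n) (fun t x => porbit g x = nth set0 O (val t))) => t.
  have : nth set0 O t \in O by apply: mem_nth; rewrite -so.
  by rewrite mem_enum => /imsetP[x _ ->]; exists x.
exists B, r; split=> [x|t|t|T d h x].
- by apply: val_inj; rewrite /= -[g x]/((g ^+ 1)%g x) porbit_perm.
- by apply: val_inj; rewrite /= hr index_uniq ?enum_uniq -?so.
- rewrite (nth_map set0) -?so //; apply: eq_card => x; rewrite inE -hr porbit_sym -eq_porbit_mem hr.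
  rewrite -val_eqE /=; apply/eqP/eqP => [<-|e]; first by rewrite nth_index.
  by rewrite -[in LHS]e index_uniq ?enum_uniq -?so.
apply: (color_inv_porbit h); rewrite -eq_porbit_mem hr /= nth_index //.
Qed.

(** Cut 0, ..., n - 1 into consecutive blocks with lengths in s and rotate each block. *)
Lemma cycle_type_perm_exists n s : all (leq 1) s -> sumn s = n ->
  exists g : 'S_n, has_cycle_type g s.
Proof.
move=> /allP pos sn.
have pos_nth t : (t < size s)%N -> (0 < nth 0 s t)%N by move=> h; apply/pos/mem_nth.
have lt_sum (x : 'I_n) : (x < sumn s)%N by rewrite sn.
have ltB (x : 'I_n) : (reshape_index s x < size s)%N by apply: reshape_indexP.
pose B x := Ordinal (ltB x).
pose c (x : 'I_n) := reshape_offset s x.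
have ltc x : (c x < nth 0 s (B x))%N by apply: reshape_offsetP.
have ltF r i : (r < size s)%N -> (i < nth 0 s r)%N -> (flatten_index s r i < n)%N.
  by move=> h1 h2; rewrite -sn flatten_indexP.
have ltm x : ((c x).+1 %% nth 0 s (B x) < nth 0 s (B x))%N by rewrite ltn_mod pos_nth /=.
pose f x := Ordinal (ltF (B x) _ (ltB x) (ltm x)).
have Bf x : B (f x) = B x by apply: val_inj; rewrite /= flatten_indexKl.
have cf x : c (f x) = ((c x).+1 %% nth 0 s (B x))%N by rewrite /c /= flatten_indexKr.
have BcK x y : B x = B y -> c x = c y -> x = y.
  move=> /(congr1 val) /= e1 e2; apply: val_inj.
  by rewrite /= -(reshape_indexK s x) -(reshape_indexK s y) -/(c x) -/(c y) e2 e1.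
have fI : injective f.
  move=> x y e; have eB : B x = B y by rewrite -Bf e Bf.
  apply: BcK => //; have := congr1 c e; rewrite !cf -eB => em.
  have lx := ltc x; have := ltc y; rewrite -eB => ly.
  move: em lx ly; set m := nth _ _ _ => em lx ly.
  have [ex|nx] := eqVneq (c x).+1 m; have [ey|ny] := eqVneq (c y).+1 m; first by lia.
  - by move: em; rewrite ex modnn modn_small; lia.
  - by move: em; rewrite ey modnn modn_small; lia.
  by move: em; rewrite !modn_small; lia.
pose r (t : 'I_(size s)) := Ordinal (ltF t 0%N (ltn_ord t) (pos_nth _ (ltn_ord t))).
exists (perm fI), B, r; split=> [x|t|t|T d h x].
- by rewrite permE Bf.
- by apply: val_inj; rewrite /= flatten_indexKl // pos_nth.
- pose h (i : 'I_(nth 0 s t)) := Ordinal (ltF t i (ltn_ord t) (ltn_ord i)).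
  have hI : injective h.
    by move=> i j e; apply: val_inj; have := congr1 c e; rewrite /c /= !flatten_indexKr.
  rewrite -[RHS]card_ord -(card_imset _ hI); apply: eq_card => x; rewrite inE.
  apply/eqP/imsetP => [e|[i _ ->]]; last by apply: val_inj; rewrite /= flatten_indexKl.
  have lt : (c x < nth 0 s t)%N by rewrite -e.
  exists (Ordinal lt) => //; apply: BcK.
    by rewrite e; apply: val_inj; rewrite /= flatten_indexKl.
  by rewrite [RHS]/c /= flatten_indexKr.
(* Induction on the offset of x in its block: the point just before x has the same color. *)
have [k] : exists k, c x = k by exists (c x).
elim: k x => [|k IH] x ck.
  congr (d _); apply: BcK; first by apply: val_inj; rewrite /= flatten_indexKl // pos_nth.
  by rewrite ck /c /= flatten_indexKr // pos_nth.
have lx := ltc x.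
have ltk : (k < nth 0 s (B x))%N by lia.
pose y := Ordinal (ltF (B x) k (ltB x) ltk).
have By : B y = B x by apply: val_inj; rewrite /= flatten_indexKl.
have cy : c y = k by rewrite /c /= flatten_indexKr.
have <- : f y = x by apply: BcK; rewrite ?Bf // cf cy By ck modn_small // -ck.
have := forallP h y; rewrite permE => /eqP ->.
by rewrite Bf; apply: IH.
Qed.

Lemma cycle_type1 n : has_cycle_type (1 : 'S_n)%g (nseq n 1%N).
Proof.
have e : n = size (nseq n 1%N) by rewrite size_nseq.
exists (cast_ord e), (cast_ord (esym e)); split=> [x|t|t|T d h x].
- by rewrite perm1.
- exact: cast_ordKV.
- have -> : nth 0%N (nseq n 1%N) t = 1%N by rewrite nth_nseq {2}e ltn_ord.
  transitivity #|[set cast_ord (esym e) t]|; last exact: cards1.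
  by apply: eq_card => x; rewrite !inE -(inj_eq (@cast_ord_inj _ _ (esym e))) cast_ordK.
by rewrite cast_ordK.
Qed.

Lemma mnv_eq l (b b' : 'I_l -> nat) s : b =1 b' -> mnv b s = mnv b' s.
Proof.
elim: s b b' => [|m s IH] b b' e /=; first by congr (\det _); apply/matrixP => i j; rewrite !mxE e.
apply: eq_bigr => i _; rewrite e; case: ifP => // _; apply: IH => k.
by rewrite /lower e.
Qed.

Lemma mnv_perm l (b : 'I_l -> nat) s (t : 'S_l) :
  mnv (fun i => b (t i)) s = (-1) ^+ t * mnv b s.
Proof.
elim: s b => [|m s IH] b /=.
  rewrite /shift_det -det_perm -det_mulmx -row_permE; congr (\det _).
  by apply/matrixP => i j; rewrite !mxE.
rewrite mulr_sumr [RHS](reindex_inj (@perm_inj _ t)); apply: eq_bigr => i _.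
case: ifP => _; last by rewrite mulr0.
rewrite -IH; apply: mnv_eq => k; by rewrite /lower (inj_eq perm_inj).
Qed.

Lemma mnv_repeat l (b : 'I_l -> nat) s i j : i != j -> b i = b j -> mnv b s = 0.
Proof.
move=> nij e; have := mnv_perm b s (tperm i j); rewrite odd_tperm nij expr1.
rewrite (@mnv_eq _ _ b) => [|k]; first by lia.
by case: tpermP => [->|->|].
Qed.

Definition mnl l (L s : seq nat) := mnv (fun i : 'I_l => nth 0%N L i) s.

Lemma mnl_swap l (A B : seq nat) x y s : size (A ++ x :: y :: B) = l ->
  mnl l (A ++ x :: y :: B) s = - mnl l (A ++ y :: x :: B) s.
Proof.
rewrite size_cat /= => sl.
have l0 : (size A < l)%N by lia. have l1 : ((size A).+1 < l)%N by lia.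
pose i := Ordinal l0; pose j := Ordinal l1.
have nij : i != j by rewrite -val_eqE /=; lia.
have := mnv_perm (fun i : 'I_l => nth 0%N (A ++ y :: x :: B) i) s (tperm i j).
rewrite odd_tperm nij expr1 mulN1r => <-; apply: mnv_eq => k.
case: tpermP => [->|->|nki nkj]; rewrite /= !nth_cat ?ltnn ?subnn //=.
- by rewrite ltnNge leqnSn /= subSn // subnn.
- by rewrite ltnNge leqnSn /= subSn // subnn.
case: ltnP => // le; case e: (k - size A)%N => [|[|//]].
  by case: nki; apply: val_inj; rewrite /=; lia.
by case: nkj; apply: val_inj; rewrite /=; lia.
Qed.

Definition sgn (k : nat) : int := if odd k then -1 else 1.

Lemma mnl_move l (A V T : seq nat) p s : size (A ++ V ++ p :: T) = l ->
  mnl l (A ++ V ++ p :: T) s = sgn (size V) * mnl l (A ++ p :: V ++ T) s.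
Proof.
elim/last_ind: V T => [|V x IH] T sl /=; first by rewrite mul1r.
have e : A ++ rcons V x ++ p :: T = (A ++ V) ++ x :: p :: T by rewrite cat_rcons catA.
rewrite e mnl_swap -?e // -catA IH; last by rewrite -sl !size_cat size_rcons /=; lia.
rewrite size_rcons cat_rcons /sgn /=; case: (odd (size V)) => /=; ring.
Qed.

(** * Murnaghan-Nakayama rule on boundary words *)

Section BoundaryWords.
(* A partition is encoded by the 0/1 word of its boundary: the trues sit at the
   beta-numbers, and removing an m-hook moves a true down by m. *)
Implicit Type w u v t : seq bool.

Fixpoint beads k w : seq nat :=
  if w is b :: w' then if b then k :: beads k.+1 w' else beads k.+1 w' else [::].

(** The size of the partition: a [true] preceded by j letters [false] is a part j, and the pairs are
    counted here by their [false]. *)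
Fixpoint area w : nat :=
  if w is b :: w' then (if b then area w' else count id w' + area w')%N else 0%N.

Definition hook w p m := ~~ nth false w p && nth false w (p + m).

Definition between w p m := take m.-1 (drop p.+1 w).

Definition remove_hook w p m :=
  take p w ++ true :: between w p m ++ false :: drop (p + m).+1 w.

(* The Murnaghan-Nakayama rule. *)
Fixpoint mn w (s : seq nat) : int :=
  if s is m :: s' then
    \sum_(0 <= p < size w - m | hook w p m) sgn (count id (between w p m)) * mn (remove_hook w p m) s'
  else 1.

Lemma beads_cat k u v : beads k (u ++ v) = beads k u ++ beads (k + size u) v.
Proof.
elim: u k => [|[] u IH] k /=; rewrite ?addn0 ?IH ?addSnnS //.
Qed.

Lemma size_beads k w : size (beads k w) = count id w.
Proof. by elim: w k => [|[] w IH] k //=; rewrite IH. Qed.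

Lemma mem_beads k w q : (q \in beads k w) = (k <= q)%N && nth false w (q - k).
Proof.
elim: w k => [|b w IH] k; first by rewrite nth_nil andbF.
have -> : (q \in beads k (b :: w)) = (b && (q == k)) || (q \in beads k.+1 w) by case: b => /=; rewrite ?inE.
rewrite IH; case: (ltngtP k q) => [lt|gt|->]; rewrite ?andbF ?andbT ?orbF /= ?subnn //.
by rewrite subnS; case: (q - k)%N (subn_gt0 k q) => [|d]; rewrite lt.
Qed.

Lemma sum_beads k w : (sumn (beads k w) = area w + k * count id w + 'C(count id w, 2))%N.
Proof.
elim: w k => [|[] w IH] k /=; first by rewrite muln0.
  2: by rewrite IH add0n mulSn; lia.
by rewrite IH add1n binS bin1 mulSn mulnS; lia.
Qed.

Lemma hookP w p m : (0 < m)%N -> hook w p m ->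
  exists u v t, [/\ w = u ++ false :: v ++ true :: t, size u = p, m = (size v).+1,
    between w p m = v & remove_hook w p m = u ++ true :: v ++ false :: t].
Proof.
move=> m0 /andP[/negbTE wp wq].
have lq : (p + m < size w)%N by case: ltnP => // h; rewrite nth_default in wq.
have lp : (p < size w)%N by lia.
exists (take p w), (between w p m), (drop (p + m).+1 w); split=> //.
  rewrite -[LHS](cat_take_drop p) (drop_nth false) // wp; congr (_ ++ _ :: _).
  rewrite /between -[LHS](cat_take_drop m.-1); congr (_ ++ _).
  rewrite drop_drop (_ : m.-1 + p.+1 = p + m)%N; last by lia.
  by rewrite (drop_nth false) // wq.
- by rewrite size_takel //; lia.
- by rewrite /between size_takel ?size_drop; lia.
Qed.

Lemma area_remove_hook w p m : (0 < m)%N -> hook w p m ->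
  (area (remove_hook w p m) + m = area w)%N /\ count id (remove_hook w p m) = count id w.
Proof.
move=> m0 /(hookP m0)[u [v [t [-> su em _ ->]]]].
have ec : count id (u ++ true :: v ++ false :: t) = count id (u ++ false :: v ++ true :: t).
  by rewrite !count_cat /= !count_cat /=; lia.
split=> //; have := sum_beads 0 (u ++ true :: v ++ false :: t).
have := sum_beads 0 (u ++ false :: v ++ true :: t); rewrite ec.
rewrite !beads_cat /= !beads_cat /= !sumn_cat /= !sumn_cat /=; lia.
Qed.

Lemma area0P w : area w = 0%N -> exists a b, w = nseq a true ++ nseq b false.
Proof.
elim: w => [|[] w IH] /=; first by exists 0%N, 0%N.
  by move/IH => [a [b ->]]; exists a.+1, b.
move/eqP; rewrite addn_eq0 => /andP[/eqP c0 /eqP/IH[a [b e]]].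
case: a e => [|a] e; first by exists 0%N, b.+1; rewrite e.
by move: c0; rewrite e /= add1n.
Qed.

Lemma beads_sorted a b : beads 0 (nseq a true ++ nseq b false) = iota 0 a.
Proof.
have H k c : beads k (nseq c false) = [::] by elim: c k => //=.
rewrite beads_cat H cats0; elim: a 0%N => //= a IH k; by rewrite IH.
Qed.

Lemma ltn_sorted_beads k w : sorted ltn (beads k w).
Proof.
elim: w k => [|b w IH] k //=; have h := IH k.+1; case: b; last exact: h.
rewrite /= (path_sortedE ltn_trans) h andbT.
by apply/allP => q; rewrite mem_beads => /andP[].
Qed.

Lemma beads_uniq k w : uniq (beads k w).
Proof. by apply: (sorted_uniq ltn_trans ltnn); apply: ltn_sorted_beads. Qed.

Lemma sum_beads_word w (G : nat -> int) :
  \sum_(i < count id w) G (nth 0%N (beads 0 w) i) = \sum_(0 <= q < size w | nth false w q) G q.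
Proof.
rewrite -(size_beads 0 w) -[LHS](big_mkord predT (fun i => G (nth 0%N (beads 0 w) i))) -(big_nth 0%N predT).
rewrite -[RHS]big_filter; apply: perm_big; apply: uniq_perm; rewrite ?filter_uniq ?iota_uniq ?beads_uniq //.
move=> q; rewrite mem_beads subn0 mem_filter mem_index_iota /=.
by case: ltnP => h; rewrite ?andbT // nth_default.
Qed.

(** Subtracting m from a bead either hits another bead, and the term vanishes by antisymmetry, or it
    removes a hook; sorting the beads again costs one sign for each bead jumped over. Since the
    lengths use up the area, the last word has beads 0, ..., l - 1 and determinant 1. *)
Lemma mnl_word w l s : count id w = l -> area w = sumn s -> all (leq 1) s ->
  mnl l (beads 0 w) s = mn w s.
Proof.
move=> cw; elim: s w cw => [|m s IH] w cw /=.
  move=> /area0P[a [b ew]] _; rewrite ew beads_sorted in cw *.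
  have ea : a = l by rewrite -cw count_cat !count_nseq /= mul1n mul0n addn0.
  rewrite /mnl /= /shift_det -[RHS](det1 _ l); congr (\det _); apply/matrixP => i j.
  by rewrite !mxE nth_iota ?ea // !add0n.
move=> aw /andP[m0 ps].
pose K p := sgn (count id (between w p m)) * mn (remove_hook w p m) s.
have E (i : 'I_l) : (if (m <= nth 0 (beads 0 w) i)%N then
    mnv (lower (fun i : 'I_l => nth 0%N (beads 0 w) i) i m) s else 0) =
    (if (m <= nth 0 (beads 0 w) i)%N && ~~ nth false w (nth 0 (beads 0 w) i - m)
     then K (nth 0 (beads 0 w) i - m)%N else 0).
  set q := nth _ _ _; case: leqP => //= lm.
  have li : (i < size (beads 0 w))%N by rewrite size_beads cw.
  have : q \in beads 0 w by apply: mem_nth.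
  rewrite mem_beads subn0 /= => wq.
  case: ifPn => [wp|]; last first.
    rewrite negbK => wp; have : (q - m)%N \in beads 0 w by rewrite mem_beads subn0.
    move/(nthP 0%N) => [j]; rewrite size_beads cw => lj ej.
    have nij : i != Ordinal lj by apply/eqP => /(congr1 val) /= e; move: ej; rewrite -e -/q; lia.
    apply: (mnv_repeat s nij); rewrite /lower eqxx eq_sym (negPf nij) /= ej //.
  have hk : hook w (q - m) m by rewrite /hook wp subnK.
  have [ar cr] := area_remove_hook m0 hk.
  rewrite /K -(IH (remove_hook w (q - m) m)) ?cr //; last by lia.
  have [u [v [t [ew su em -> ->]]]] := hookP m0 hk.
  have ebw : beads 0 w = beads 0 u ++ beads (size u).+1 v ++ q :: beads q.+1 t.
    rewrite {1}ew beads_cat /= beads_cat /= add0n; congr (_ ++ _ ++ _ :: beads _ _); lia.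
  have ei : (i = size (beads 0 u ++ beads (size u).+1 v) :> nat).
    have : nth 0%N (beads 0 w) (size (beads 0 u ++ beads (size u).+1 v)) = q.
      by rewrite ebw catA nth_cat ltnn subnn.
    move/eqP; rewrite /q nth_uniq // => [/eqP -> //| |].
      by rewrite ebw catA [X in (_ < X)%N]size_cat /=; lia.
    exact: beads_uniq.
  have ebs : beads 0 (u ++ true :: v ++ false :: t) =
      beads 0 u ++ (q - m)%N :: beads (size u).+1 v ++ beads q.+1 t.
    by rewrite beads_cat /= beads_cat /= add0n; congr (_ ++ _ :: _ ++ beads _ _); lia.
  rewrite ebs -[count id v](size_beads (size u).+1) -mnl_move; last first.
    by rewrite -cw -(size_beads 0) ebw !size_cat.
  apply: mnv_eq => k; rewrite /lower -!/(nth _ _ _) ebw !catA !nth_cat -val_eqE /= ei.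
  case: ltngtP => h; last by rewrite h subnn.
    by [].
  by case e: (k - _)%N => [|d] //; move: e; lia.
rewrite /mnl /= (eq_bigr _ (fun i _ => E i)) -cw.
rewrite (sum_beads_word w (fun q => if (m <= q)%N && ~~ nth false w (q - m) then K (q - m)%N else 0)).
have [lm|gm] := leqP m (size w); last first.
  rewrite [RHS]big_geq; last by lia.
  by rewrite big_nat_cond big1 // => q /andP[/andP[_ h] _]; rewrite [(m <= q)%N]leqNgt (ltn_trans h gm).
rewrite (big_cat_nat (n := m)) //= big_nat_cond big1 ?add0r => [|q /andP[/andP[_ h] _]]; last first.
  by rewrite [(m <= q)%N]leqNgt h.
rewrite -{1}[m]add0n big_addn big_mkcond [RHS]big_mkcond; apply: eq_bigr => p _.
by rewrite leq_addl addnK /hook; case: (nth false w (p + m)); case: (nth false w p).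
Qed.

Lemma hook_cat u v t :
  [/\ hook (u ++ false :: v ++ true :: t) (size u) (size v).+1,
      between (u ++ false :: v ++ true :: t) (size u) (size v).+1 = v &
      remove_hook (u ++ false :: v ++ true :: t) (size u) (size v).+1 = u ++ true :: v ++ false :: t].
Proof.
have eb : between (u ++ false :: v ++ true :: t) (size u) (size v).+1 = v.
  by rewrite /between -cat_rcons drop_size_cat ?size_rcons // take_size_cat.
split=> //.
  by rewrite /hook !nth_cat ltnn subnn ltnNge leq_addr /= addKn /= nth_cat ltnn subnn.
rewrite /remove_hook eb take_size_cat //; congr (_ ++ _ :: _ ++ _ :: _).
by rewrite -cat_rcons catA -cat_rcons drop_size_cat // size_rcons size_cat size_rcons; lia.
Qed.

Definition conjw w := rev (map negb w).

Lemma conjwK : involutive conjw.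
Proof. by move=> w; rewrite /conjw map_rev revK -map_comp map_id_in // => b; rewrite /= negbK. Qed.

Lemma size_conjw w : size (conjw w) = size w.
Proof. by rewrite size_rev size_map. Qed.

Lemma conjw_cat u v : conjw (u ++ v) = conjw v ++ conjw u.
Proof. by rewrite /conjw map_cat rev_cat. Qed.

Lemma conjw_cons b w : conjw (b :: w) = conjw w ++ [:: ~~ b].
Proof. by rewrite /conjw /= rev_cons cats1. Qed.

Lemma count_conjw w : (count id (conjw w) + count id w = size w)%N.
Proof. by rewrite /conjw count_rev count_map -(count_predC id w) addnC. Qed.

Lemma area_cat u v : (area (u ++ v) = area u + (size u - count id u) * count id v + area v)%N.
Proof.
elim: u => [|[] u IH] //=; rewrite IH ?add1n ?subSS ?add0n // count_cat.
rewrite subSn ?count_size // mulSn; lia.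
Qed.

Lemma area_conjw w : area (conjw w) = area w.
Proof.
elim: w => [|b w IH] //; rewrite conjw_cons area_cat IH /= size_conjw.
by have := count_conjw w; case: b => /=; lia.
Qed.

Lemma hook_conjw w p m : (0 < m)%N -> hook w p m ->
  let q := (size w - m.+1 - p)%N in
  [/\ hook (conjw w) q m, between (conjw w) q m = conjw (between w p m) &
      remove_hook (conjw w) q m = conjw (remove_hook w p m)].
Proof.
move=> m0 /(hookP m0)[u [v [t [ew su em -> ->]]]] q.
have ec : conjw w = conjw t ++ false :: conjw v ++ true :: conjw u.
  by rewrite ew !conjw_cat !conjw_cons !conjw_cat !conjw_cons /= -!catA.
have [] := hook_cat (conjw t) (conjw v) (conjw u); rewrite !size_conjw -ec -em.
have -> : size t = q by rewrite /q ew size_cat /= size_cat /=; lia.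
move=> -> -> ->; split=> //.
by rewrite !conjw_cat !conjw_cons !conjw_cat !conjw_cons /= -!catA.
Qed.

Lemma sgnB a b : (b <= a)%N -> sgn (a - b) = sgn a * sgn b.
Proof. by move=> le; rewrite /sgn oddB //; case: odd; case: odd. Qed.

(** The sign of a permutation of cycle type s. *)
Definition type_sgn (s : seq nat) : int := \prod_(m <- s) sgn m.-1.

(** Conjugation replaces the leg length h of a hook of length m by m - 1 - h. *)
Lemma mn_conjw w s : all (leq 1) s -> mn (conjw w) s = type_sgn s * mn w s.
Proof.
elim: s w => [|m s IH] w; first by rewrite /type_sgn big_nil mulr1.
rewrite [all _ _]/= => /andP[m0 ps].
rewrite /type_sgn big_cons -/(type_sgn s) /= size_conjw big_nat_rev add0n mulr_sumr big_nat_cond [RHS]big_nat_cond.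
have eq p : (p < size w - m)%N -> (size w - m - p.+1 = size w - m.+1 - p)%N by lia.
apply: eq_big => [p|p /andP[/andP[_ lp] hp]].
  apply: andb_id2l => /andP[_ lp]; rewrite eq //; apply/idP/idP => [h|h].
    have [] := hook_conjw m0 h; rewrite conjwK size_conjw.
    by rewrite (_ : size w - m.+1 - _ = p)%N //; lia.
  by have [] := hook_conjw m0 h.
rewrite eq // in hp *; have hp' : hook w p m.
  have [] := hook_conjw m0 hp; rewrite conjwK size_conjw.
  by rewrite (_ : size w - m.+1 - _ = p)%N //; lia.
have [_ -> ->] := hook_conjw m0 hp'; rewrite IH //.
have := count_conjw (between w p m).
have [u [v [t [_ _ em -> _]]]] := hookP m0 hp'.
move=> ec; have -> : count id (conjw v) = (size v - count id v)%N by lia.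
rewrite sgnB ?count_size // em /=; ring.
Qed.

(** A leading [true] is a part 0: its position is occupied, so no bead can be moved there, and it
    lies between the ends of no hook. *)
Lemma mn_true w s : all (leq 1) s -> mn (true :: w) s = mn w s.
Proof.
elim: s w => [|m s IH] w //= /andP[m0 ps].
have [lt|le] := ltnP (size w) m.
  by rewrite !big_geq //; lia.
rewrite subSn // big_mkcond big_nat_recl //= add0r [RHS]big_mkcond; apply: eq_bigr => p _.
rewrite -[hook (true :: w) p.+1 m]/(hook w p m) -[between (true :: w) p.+1 m]/(between w p m).
by rewrite -[remove_hook (true :: w) p.+1 m]/(true :: remove_hook w p m) IH.
Qed.

Lemma type_sgn_sq s : type_sgn s * type_sgn s = 1.
Proof.
rewrite /type_sgn -big_split /=; apply: big1 => m _; rewrite /sgn; by case: odd.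
Qed.

Lemma mn_false w s : all (leq 1) s -> mn (w ++ [:: false]) s = mn w s.
Proof.
move=> ps; rewrite -[LHS]mul1r -(type_sgn_sq s) -mulrA -mn_conjw // conjw_cat /= mn_true //.
by rewrite mn_conjw // mulrA type_sgn_sq mul1r.
Qed.

Lemma mn_trues a w s : all (leq 1) s -> mn (nseq a true ++ w) s = mn w s.
Proof. by move=> ps; elim: a => //= a IH; rewrite mn_true. Qed.

Lemma mn_falses w b s : all (leq 1) s -> mn (w ++ nseq b false) s = mn w s.
Proof.
by move=> ps; elim: b w => [|b IH] w; rewrite ?cats0 // -[nseq b.+1 false]/([:: false] ++ nseq b false) catA IH mn_false.
Qed.

(** * Degrees: branching rule and lower bounds *)

Definition dim w := mn w (nseq (area w) 1%N).

Lemma corner_exists w : (0 < area w)%N -> exists u v, w = u ++ false :: true :: v.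
Proof.
elim: w => // b w IH; case: (posnP (area w)) => [a0|/IH[u [v ->]]] ; last first.
  by exists (b :: u), v.
case: b => /=; first by rewrite a0.
case: w a0 {IH} => [|[] w] //= h; first by exists [::], w.
by rewrite add0n; lia.
Qed.

Definition corners w := [seq p <- iota 0 (size w - 1) | hook w p 1].

Lemma mem_corners w p : (p \in corners w) = hook w p 1.
Proof.
rewrite mem_filter mem_iota /= add0n; case: (boolP (hook w p 1)) => //= hp.
by case: ltnP => // h; move: hp; rewrite /hook andbC nth_default //; lia.
Qed.

Lemma corners_uniq w : uniq (corners w).
Proof. by rewrite filter_uniq ?iota_uniq. Qed.

(** The branching rule; no bead lies strictly between p and p + 1, so all signs are +1. *)
Lemma dimE w : (0 < area w)%N ->
  dim w = \sum_(p <- corners w) dim (remove_hook w p 1).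
Proof.
case ea: (area w) => [//|k] _; rewrite /corners big_filter /dim ea /= /index_iota subn0.
apply: eq_bigr => p hp; have [e _] := area_remove_hook (ltn0Sn 0) hp.
rewrite /between take0 /= mul1r; congr (mn _ (nseq _ _)); lia.
Qed.

Lemma dim_gt0 w : 0 < dim w.
Proof.
have [k] := ubnP (area w); elim: k w => // k IH w lk.
case: (posnP (area w)) => [a0|a0]; first by rewrite /dim a0.
have [u [v ew]] := corner_exists a0; rewrite dimE //.
have [h _ _] := hook_cat u [::] v; rewrite /= -ew -mem_corners in h.
have pos p : p \in corners w -> 0 < dim (remove_hook w p 1).
  by rewrite mem_corners => hp; have [e _] := area_remove_hook (ltn0Sn 0) hp; apply: IH; lia.
rewrite (bigD1_seq (size u)) ?corners_uniq //=; apply: ltr_wpDr; last exact: pos.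
by rewrite big_seq_cond; apply: sumr_ge0 => p /andP[hp _]; apply/ltW/pos.
Qed.

Lemma dim_ge1 w p : hook w p 1 -> dim (remove_hook w p 1) <= dim w.
Proof.
move=> hp; have [e _] := area_remove_hook (ltn0Sn 0) hp.
rewrite (@dimE w); last by lia.
rewrite (bigD1_seq p) ?corners_uniq ?mem_corners //= lerDl.
by apply: sumr_ge0 => q _; apply/ltW/dim_gt0.
Qed.

Lemma dim_ge2 w p q : p != q -> hook w p 1 -> hook w q 1 ->
  dim (remove_hook w p 1) + dim (remove_hook w q 1) <= dim w.
Proof.
move=> npq hp hq; have [e _] := area_remove_hook (ltn0Sn 0) hp.
rewrite (@dimE w); last by lia.
rewrite (bigD1_seq p) ?corners_uniq ?mem_corners //= lerD2l.
have hr : q \in [seq r <- corners w | r != p] by rewrite mem_filter mem_corners hq eq_sym npq.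
rewrite -big_filter (bigD1_seq q hr (filter_uniq _ (corners_uniq w))) /= lerDl.
by apply: sumr_ge0 => r _; apply/ltW/dim_gt0.
Qed.

Lemma dim_conjw w : dim (conjw w) = dim w.
Proof.
rewrite /dim area_conjw mn_conjw ?all_nseq ?orbT // /type_sgn big_nseq -[RHS]mul1r; congr (_ * _).
by elim: area => //= k ->.
Qed.

(** The beads of the word are the entries of the b of [irr_frob] in increasing order. Sorting
    changes the values by one global sign, and the total sign is +1 because chi(1) and [dim w] are
    both positive. *)
Lemma irr_word n (i : Iirr (SymG n)) : exists w, [/\ count id w = n, area w = n &
  forall g s, has_cycle_type g s -> all (leq 1) s -> sumn s = n ->
    'chi_i g = (mn w s)%:~R].
Proof.
have [b [injb sb] [e ei]] := irr_frob i.
pose L := sort leq (codom b).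
have uL : uniq L by rewrite sort_uniq; apply/injectiveP.
have sL : size L = n by rewrite size_sort size_codom card_ord.
pose M := (sumn L).+1.
pose w := mkseq (fun q => q \in L) M.
have ltM q : q \in L -> (q < M)%N.
  move=> qL; rewrite ltnS sumnE (big_rem q) //= leq_addr //.
have bw : beads 0 w = L.
  apply: (irr_sorted_eq ltn_trans ltnn); first exact: ltn_sorted_beads.
    by rewrite ltn_sorted_uniq_leq uL sort_sorted //; apply: leq_total.
  move=> q; rewrite mem_beads subn0 /=; case: (ltnP q M) => h; first by rewrite nth_mkseq.
  by rewrite nth_default ?size_mkseq //; apply/esym/negbTE/negP => /ltM; lia.
have cw : count id w = n by rewrite -(size_beads 0) bw.
have aw : area w = n.
  have := sum_beads 0 w; rewrite cw bw mul0n addn0 (perm_sumn (permEl (perm_sort _ _))).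
  by rewrite sumnE big_map big_enum /= sb; lia.
have [t ht] : exists t : 'S_n, forall k, b k = nth 0%N L (t k).
  have pe : perm_eq [tuple b k | k < n] [tuple nth 0%N L k | k < n].
    rewrite /= (_ : [seq nth _ _ _ | _ <- _] = L).
      by rewrite perm_sym perm_sort.
    by rewrite -[RHS](mkseq_nth 0%N) sL /mkseq -val_enum_ord -map_comp.
  case/tuple_permP: pe => t et; exists t => k.
  have : [tuple b k | k < n] = [tuple tnth [tuple nth 0%N L k | k < n] (t k) | k < n] by apply: val_inj.
  by move=> /(congr1 (fun u : n.-tuple nat => tnth u k)); rewrite !tnth_mktuple.
exists w; split=> //.
pose e' := (-1) ^+ e * (-1) ^+ t : int.
have H g s : has_cycle_type g s -> all (leq 1) s -> sumn s = n -> 'chi_i g = (e' * mn w s)%:~R.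
  move=> hg ps ss; rewrite ei cfunE (frob_mnv _ hg).
  have -> : mnv b s = (-1) ^+ t * mnl n L s by rewrite (mnv_eq _ ht) /mnl -mnv_perm.
  by rewrite -bw mnl_word ?ss // /e' !rmorphM /= !rmorph_sign mulrA.
have := H 1%g (nseq n 1%N) (cycle_type1 n); rewrite all_nseq orbT sumn_nseq mul1n => /(_ isT erefl) h1.
have : 0 < (e' * dim w)%:~R :> algC by rewrite /dim aw -h1 irr1_gt0.
rewrite ltr0z => pos g s hg ps ss; rewrite (H _ _ hg) //.
suff -> : e' = 1 by rewrite mul1r.
move: pos (dim_gt0 w); rewrite /e'; case: (e); case: (odd_perm t); rewrite ?expr1 ?expr0 ?mulN1r ?mul1r ?opprK //; lia.
Qed.

Lemma dim_corner u v : dim (u ++ true :: false :: v) <= dim (u ++ false :: true :: v).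
Proof. by have [h _ <-] := hook_cat u [::] v; apply: dim_ge1. Qed.

Lemma dim_corner2 u v u' v' : size u != size u' ->
  u ++ false :: true :: v = u' ++ false :: true :: v' ->
  dim (u ++ true :: false :: v) + dim (u' ++ true :: false :: v') <= dim (u ++ false :: true :: v).
Proof.
move=> ns e; have [h _ <-] := hook_cat u [::] v; have [h' _ <-] := hook_cat u' [::] v'.
by rewrite /= -e in h' *; apply: dim_ge2.
Qed.

Lemma area_rcons_true u : area (u ++ [:: true]) = (area u + count negb u)%N.
Proof. by rewrite area_cat /= muln1 addn0 -(count_predC id u) addKn. Qed.

Lemma area_trail w r : area (w ++ nseq r false) = area w.
Proof.
rewrite area_cat count_nseq /= mul0n muln0 addn0.
by have -> : area (nseq r false) = 0%N; rewrite ?addn0 //; elim: r => //= r ->; rewrite count_nseq.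
Qed.

(* [ballot k c] is the number of standard tableaux of shape (c, k). *)
Fixpoint ballot k : nat -> nat :=
  if k is k'.+1 then
    fix row c := if c is c'.+1 then (ballot k' c + (if k < c then row c' else 0))%N else ballot k' 0
  else fun=> 1%N.

Lemma ballotSS k c : ballot k.+1 c.+1 = (ballot k c.+1 + (if k < c then ballot k.+1 c else 0))%N.
Proof. by []. Qed.

(** The word encodes (c, nu) with c = [count negb u] and |nu| = [area u]. Removing a corner of nu
    and, if |nu| < c, a box of the first row reproduces the recursion of [ballot]. *)
Lemma dim_ge_ballot u r : (area u <= count negb u)%N ->
  (ballot (area u) (count negb u))%:R <= dim (u ++ true :: nseq r false).
Proof.
have [k] := ubnP (area u + count negb u); elim: k u r => // k IH u r lk le.
case: (posnP (area u)) => [->|a0]; first by have := dim_gt0 (u ++ true :: nseq r false) => /=; lia.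
have [u1 [v1 eu]] := corner_exists a0.
have ew : u ++ true :: nseq r false = u1 ++ false :: true :: v1 ++ true :: nseq r false by rewrite eu -catA.
pose u2 := u1 ++ true :: false :: v1.
have a2 : (area u2 + 1 = area u)%N.
  have [h _ e] := hook_cat u1 [::] v1; rewrite /u2 eu -[u1 ++ true :: _]e.
  by have [] := area_remove_hook (ltn0Sn 0) h.
have c2 : count negb u2 = count negb u by rewrite /u2 eu !count_cat /=; lia.
have IH2 := IH u2 r; rewrite c2 in IH2.
have := IH2 ltac:(lia) ltac:(lia); rewrite {1}/u2 -catA /= => {}IH2.
case ek: (area u) a0 => [//|k'] _; case ec: (count negb u) => [|c']; first by lia.
rewrite ballotSS natrD; have e2 : area u2 = k' by lia.
rewrite e2 ec in IH2.
case: ifP => [lt|_]; last first.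
  by rewrite addr0; apply: le_trans IH2 _; rewrite ew; apply: dim_corner.
case/lastP: u ek ec le lk ew eu c2 a2 => [//|u' b] ek ec le lk ew eu c2 a2.
(* If u ended in [true], the second row would be as long as the first, against |nu| < c. *)
case: b ek ec le lk ew eu c2 a2; rewrite -cats1 => ek ec le lk ew eu c2 a2.
  move: ek ec; rewrite area_rcons_true count_cat /=; lia.
have ea : area (u' ++ [:: false]) = area u' by rewrite (area_trail u' 1).
have ecn : count negb (u' ++ [:: false]) = (count negb u').+1 by rewrite count_cat /= addn1.
have cu : count negb u' = c' by lia.
have := IH u' r.+1; rewrite -ea ek cu => IH1; have {}IH1 := IH1 ltac:(lia) ltac:(lia).
apply: (le_trans (lerD IH2 IH1)).
rewrite ew; apply: dim_corner2; last by rewrite -ew -catA.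
by have := congr1 size eu; rewrite !size_cat /=; lia.
Qed.

Lemma ballot1 c : (1 <= c)%N -> ballot 1 c = c.
Proof. by elim: c => // -[//|c] IH _; rewrite ballotSS /= -/(ballot 1 c.+1) IH //; lia. Qed.

Lemma ballot2 c : (2 <= c)%N -> (2 * ballot 2 c = (c + 2) * (c - 1))%N.
Proof.
elim: c => // c IH le; rewrite ballotSS ballot1 //.
by case: ltnP => h; [have := IH h; nia | have -> : c = 1%N by lia].
Qed.

Lemma ballot3 c : (3 <= c)%N -> (6 * ballot 3 c = (c + 3) * (c + 2) * (c - 2))%N.
Proof.
elim: c => // c IH le; rewrite ballotSS; have := @ballot2 c.+1 ltac:(lia).
by case: ltnP => h; [have := IH h; nia | have -> : c = 2%N by lia].
Qed.

Lemma ballot4 c : (4 <= c)%N -> (24 * ballot 4 c = (c + 4) * (c + 3) * (c + 2) * (c - 3))%N.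
Proof.
elim: c => // c IH le; rewrite ballotSS; have := @ballot3 c.+1 ltac:(lia).
by case: ltnP => h; [have := IH h; nia | have -> : c = 3%N by lia].
Qed.

(* Length of the first row of the encoded partition. *)
Fixpoint row1 w : nat :=
  if w is b :: w' then if has id w then (~~ b + row1 w')%N else 0%N else 0%N.

Definition rows w := row1 (conjw w).

Lemma row1_cat u v : row1 (u ++ v) = if has id v then (count negb u + row1 v)%N else row1 u.
Proof.
elim: u => [|b u IH] /=; first by case: v => //= b v; case: ifP.
rewrite has_cat IH; case: (has id v); rewrite ?orbT ?orbF //; lia.
Qed.

Lemma row1_last u r : row1 (u ++ true :: nseq r false) = count negb u.
Proof. by rewrite row1_cat /= add0n; case: r => [|r]; rewrite /= ?has_nseq ?andbF addn0. Qed.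

Lemma last_true_split w : has id w -> exists u r, w = u ++ true :: nseq r false.
Proof.
elim: w => // b w IH /=; case h: (has id w); [move=> _|].
  by have [u [r ->]] := IH h; exists (b :: u), r.
rewrite orbF; case: b => // _; exists [::], (size w) => /=; congr (_ :: _).
by apply/all_pred1P/allP => x; move/negbT/hasPn: h => h /h; case: x.
Qed.

Lemma row1_remove u v : (row1 (u ++ true :: false :: v) <= row1 (u ++ false :: true :: v))%N.
Proof. by rewrite !row1_cat /=; case: (has id v) => /=; lia. Qed.

Lemma rows_remove u v : (rows (u ++ true :: false :: v) <= rows (u ++ false :: true :: v))%N.
Proof. by rewrite /rows !conjw_cat !conjw_cons /= -!catA /=; apply: row1_remove. Qed.

Definition high w := (row1 w + 4 <= area w)%N && (rows w + 4 <= area w)%N.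

Fixpoint ltrim w := if w is true :: w' then ltrim w' else w.
(** Many words encode the same partition. Stripping leading [true] and trailing [false] letters
    picks a canonical one; this is unrelated to the p-cores of modular representation theory. *)
Definition core w := conjw (ltrim (conjw (ltrim w))).

Lemma ltrimE w : exists a, w = nseq a true ++ ltrim w.
Proof. by elim: w => [|[] w [a ea]]; [exists 0%N | exists a.+1; rewrite {1}ea | exists 0%N]. Qed.

Lemma head_ltrim w : ~~ head false (ltrim w).
Proof. by elim: w => // -[]. Qed.

Lemma area_trues a w : area (nseq a true ++ w) = area w.
Proof. by elim: a. Qed.

Lemma area_ltrim w : area (ltrim w) = area w.
Proof. by elim: w => // -[]. Qed.

Lemma area_core w : area (core w) = area w.
Proof. by rewrite /core area_conjw area_ltrim area_conjw area_ltrim. Qed.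

Lemma mn_ltrim w s : all (leq 1) s -> mn (ltrim w) s = mn w s.
Proof. by move=> ps; elim: w => // -[] w //= IH; rewrite mn_true. Qed.

Lemma mn_core w s : all (leq 1) s -> mn (core w) s = mn w s.
Proof.
move=> ps; rewrite /core mn_conjw // mn_ltrim // -[in RHS](mn_ltrim w ps).
by rewrite mn_conjw // mulrA type_sgn_sq mul1r.
Qed.

Lemma dim_core w : dim (core w) = dim w.
Proof. by rewrite /dim area_core mn_core ?all_nseq ?orbT. Qed.

Lemma rows_ltrim w : rows (ltrim w) = rows w.
Proof.
have [a ew] := ltrimE w; rewrite [in RHS]ew /rows conjw_cat row1_cat.
by rewrite /conjw map_nseq /= rev_nseq has_nseq andbF.
Qed.

Lemma row1_ltrim w : row1 (ltrim w) = row1 w.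
Proof. by elim: w => // -[] w //= ->; case: w. Qed.

Lemma row1_core w : row1 (core w) = row1 w.
Proof.
by rewrite /core -/(rows (ltrim _)) rows_ltrim /rows conjwK row1_ltrim.
Qed.

Lemma rows_core w : rows (core w) = rows w.
Proof. by rewrite /core {1}/rows conjwK row1_ltrim -/(rows (ltrim w)) rows_ltrim. Qed.

Definition iscore w := ~~ head true w && last false w.

Lemma last_conjw w b : last b (conjw w) = if w is c :: _ then ~~ c else b.
Proof. by case: w => // c w; rewrite conjw_cons last_cat. Qed.

Lemma head_conjw w b : head b (conjw w) = if w is c :: w' then ~~ last c w' else b.
Proof. by case/lastP: w => // w c; rewrite -cats1 conjw_cat /=; case: w => //= d w; rewrite last_cat. Qed.

Lemma last_ltrim w b : has negb w -> last b (ltrim w) = last b w.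
Proof.
move=> hn; have [a ea] := ltrimE w; rewrite [in RHS]ea last_cat.
case e: (ltrim w) => [|c v] //; move: hn; rewrite ea e cats0.
by rewrite has_nseq andbF.
Qed.

Lemma iscore_core w : (0 < area w)%N -> iscore (core w).
Proof.
rewrite -area_core /iscore /core; set v := ltrim w; set x := ltrim (conjw v).
rewrite area_conjw head_conjw last_conjw; have hx : ~~ head false x by apply: head_ltrim.
case ex: x hx => [|c y] //= hc ax; rewrite hc andbT negbK.
have hn : has negb (conjw v).
  by have [a ->] := ltrimE (conjw v); rewrite has_cat -/x ex /= hc /= orbT.
have := last_ltrim false hn; rewrite -/x ex /= => ->; rewrite last_conjw.
have : ~~ head false v by apply: head_ltrim.
have : area v != 0%N by rewrite -area_conjw -area_ltrim -/x ex -lt0n.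
by case: (v) => // b u.
Qed.

Lemma size_iscore c : iscore c -> (size c <= (area c).+1)%N.
Proof.
case: c => [|[] c] //; rewrite /iscore /=; case/lastP: c => // y b; rewrite last_rcons => ->.
rewrite -cats1 count_cat area_rcons_true size_cat /=.
have e : (count id y + count negb y = size y)%N := count_predC id y.
by lia.
Qed.

(** Words are built from the right, and the filter is inherited by suffixes: a suffix of a word
    ending in [true] is empty or ends in [true], and its area is no larger. Thus the pruning loses
    nothing. *)
Fixpoint bounded_words N k : seq (seq bool) :=
  if k is k'.+1 then
    let t := bounded_words N k' in
    [::] :: [seq w <- [seq true :: w | w <- t] ++ [seq false :: w | w <- t] | last true w && (area w <= N)%N]
  else [:: [::]].

Lemma mem_bounded_words N k w : (size w <= k)%N -> last true w -> (area w <= N)%N ->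
  w \in bounded_words N k.
Proof.
elim: k w => [|k IH] [|b w] //= lk lw la.
rewrite inE mem_filter /= lw la /= mem_cat.
have {}IH : w \in bounded_words N k.
  apply: IH => //; last by case: b la {lw} => /=; lia.
  by case: w lw {lk la} => // c w; case: c.
by case: b {la lw}; rewrite !map_f ?orbT.
Qed.

Definition cores N := [seq w <- bounded_words N N.+1 | iscore w && (area w == N)].

Lemma mem_cores w : (0 < area w)%N -> core w \in cores (area w).
Proof.
move=> a0; have ic := iscore_core a0.
rewrite mem_filter ic area_core eqxx andTb.
apply: mem_bounded_words; rewrite ?area_core //.
  by have := size_iscore ic; rewrite area_core.
by move: ic => /andP[_]; case: (core w) => // b v; case: v.
Qed.

Definition lookup (t : seq (seq bool * nat)) w :=
  foldr (fun x acc => if x.1 == w then x.2 else acc) 0%N t.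

(* Entries are lower bounds for the dimensions, truncated at 1000 > 'C(14, 3). *)
Fixpoint dim_table n : seq (seq bool * nat) :=
  if n is n'.+1 then
    let t := dim_table n' in
    [seq (w, minn 1000 (sumn [seq lookup t (core (remove_hook w p 1)) | p <- corners w])) | w <- cores n]
  else [:: ([::], 1%N)].

Lemma lookup_mem (t : seq (seq bool * nat)) w : lookup t w = 0%N \/ (w, lookup t w) \in t.
Proof.
elim: t => [|[v d] t IH] /=; first by left.
by case: (v =P w) => [->|_]; rewrite inE ?eqxx; [right | case: IH => [->|->]; [left | right; rewrite orbT]].
Qed.

Lemma dim_tableP n w d : (w, d) \in dim_table n -> area w = n /\ d%:R <= dim w.
Proof.
elim: n w d => [|n IH] w d; first by rewrite inE => /eqP[-> ->].
rewrite /dim_table -/dim_table; set t := dim_table n.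
case/mapP=> v; rewrite mem_filter => /andP[/andP[_ /eqP av] _] [-> ->]; split=> //.
rewrite dimE ?av //.
apply: (@le_trans _ _ (sumn [seq lookup t (core (remove_hook v p 1)) | p <- corners v])%:R).
  by rewrite ler_nat geq_minr.
rewrite sumnE big_map natr_sum; apply: ler_sum => p _.
(* The default 0 of a failed lookup is still a lower bound for a degree. *)
rewrite -dim_core; have [->|/IH[_ ->//]] := lookup_mem t (core (remove_hook v p 1)).
exact/ltW/dim_gt0.
Qed.

Lemma mem_dim_table w : (0 < area w)%N -> exists d, (core w, d) \in dim_table (area w).
Proof.
move=> a0; have := mem_cores a0; case ea: (area w) a0 => [//|n] _ mc.
by eexists; apply/mapP; exists (core w) => //.
Qed.

Lemma high_core w : high (core w) = high w.
Proof. by rewrite /high row1_core rows_core area_core. Qed.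

Lemma dim_table_check :
  all (fun n => all (fun x => high x.1 ==> ('C(n, 3) <= x.2)%N) (dim_table n)) [:: 13; 14]%N.
Proof. by vm_compute. Qed.

Lemma dim_high_base w : area w \in [:: 13; 14]%N -> high w -> ('C(area w, 3))%:R <= dim w.
Proof.
move=> aw; have a0 : (0 < area w)%N by move: aw; rewrite !inE => /orP[] /eqP ->.
have [d hd] := mem_dim_table a0; have [_] := dim_tableP hd.
rewrite dim_core -high_core => le hw; apply: le_trans le; rewrite ler_nat.
exact: (implyP (allP (allP dim_table_check _ aw) _ hd) hw).
Qed.

Lemma bin2E n : (2 * 'C(n, 2) = n * (n - 1))%N.
Proof. by elim: n => // n IH; rewrite binS bin1; nia. Qed.

Lemma bin3E n : (6 * 'C(n, 3) = n * (n - 1) * (n - 2))%N.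
Proof. by elim: n => // n IH; rewrite binS; have := bin2E n; nia. Qed.

(** The bound is the degree n(n-1)(n-2)(n-7)/24 of (n-4,4), and n - 7 >= 4. *)
Lemma dim_row1_4 w : (11 <= area w)%N -> (row1 w + 4 = area w)%N -> ('C(area w, 3))%:R <= dim w.
Proof.
move=> le e; have hw : has id w.
  by apply: contraTT le => nh; rewrite -e; case: (w) nh => //= b v /negPf ->.
have [u [r ew]] := last_true_split hw; move: e.
rewrite ew row1_last.
have -> : area (u ++ true :: nseq r false) = (area u + count negb u)%N.
  by rewrite -cat1s catA area_trail area_rcons_true.
move=> e; have au : area u = 4 by lia.
have c7 : (7 <= count negb u)%N by move: le; rewrite ew -cat1s catA area_trail area_rcons_true; lia.
have := @dim_ge_ballot u r; rewrite au => h.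
apply: (le_trans _ (h _)); last by lia.
rewrite ler_nat; set c := count negb u in e c7 *.
have := @ballot4 c ltac:(lia); have := bin3E (4 + c).
rewrite (_ : 4 + c - 1 = c + 3)%N; last by lia.
rewrite (_ : 4 + c - 2 = c + 2)%N; last by lia.
move: (ballot 4 c) ('C(4 + c, 3)) => b B h1 h2.
suff: (24 * B <= 24 * b)%N by lia.
have -> : (24 * B = 4 * (6 * B))%N by lia.
by rewrite h1 h2; nia.
Qed.

Lemma remove_corner u v : let w := u ++ false :: true :: v in let w' := u ++ true :: false :: v in
  [/\ area w = (area w').+1, (row1 w' <= row1 w)%N & (rows w' <= rows w)%N].
Proof.
move=> w w'; split; [|exact: row1_remove|exact: rows_remove].
have [h _ e] := hook_cat u [::] v.
by have [] := area_remove_hook (ltn0Sn 0) h; rewrite /= e -/w' -/w; lia.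
Qed.

Lemma bin3_step n : (15 <= n)%N -> ('C(n, 3) <= 2 * 'C(n - 2, 3))%N.
Proof.
move=> le; have [p ep] : exists p, n = p.+4 by exists (n - 4)%N; lia.
have -> : (n - 2 = p.+2)%N by lia.
have := bin3E n; have := bin3E p.+2; rewrite ep.
have -> : (p.+4 - 1 = p.+3)%N by lia.
have -> : (p.+4 - 2 = p.+2)%N by lia.
have -> : (p.+2 - 1 = p.+1)%N by lia.
have -> : (p.+2 - 2 = p)%N by lia.
move: ('C(p.+4, 3)) ('C(p.+2, 3)) => A B hB hA.
have q : (p.+4 * p.+3 <= 2 * (p.+1 * p))%N by nia.
have : (p.+2 * (p.+4 * p.+3) <= p.+2 * (2 * (p.+1 * p)))%N by rewrite leq_mul2l q.
rewrite (_ : p.+2 * (p.+4 * p.+3) = p.+4 * p.+3 * p.+2)%N; last by ring.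
rewrite (_ : p.+2 * (2 * (p.+1 * p)) = 2 * (p.+2 * p.+1 * p))%N; last by ring.
by rewrite -hA -hB; lia.
Qed.

(** If the first row or column has length exactly n - 4, [dim_row1_4] applies. Otherwise removing a
    corner preserves [high]. Two corners give at least 2 C(n-1, 3). A rectangle has one corner, but
    two after its removal, which gives at least 2 C(n-2, 3). Both are at least C(n, 3) by
    [bin3_step]. *)
Lemma dim_high w : (13 <= area w)%N -> high w -> ('C(area w, 3))%:R <= dim w.
Proof.
have [k] := ubnP (area w); elim: k w => // k IH w lk le hw.
have [lt15|ge15] := ltnP (area w) 15.
  by apply: dim_high_base => //; rewrite !inE; lia.
move: (hw) => /andP[h1 h2].
have [e1|n1] := eqVneq (row1 w + 4)%N (area w); first by apply: dim_row1_4 => //; lia.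
have [e2|n2] := eqVneq (rows w + 4)%N (area w).
  rewrite -dim_conjw -(area_conjw w); apply: dim_row1_4; rewrite area_conjw //; lia.
have two (x y : int) m : (m = area w - 1 \/ m = area w - 2)%N ->
    ('C(m, 3))%:R <= x -> ('C(m, 3))%:R <= y -> x + y <= dim w -> ('C(area w, 3))%:R <= dim w.
  move=> em hx hy hxy; have s := bin3_step ge15.
  have : ('C(area w - 2, 3) <= 'C(m, 3))%N by apply: leq_bin2l; lia.
  by lia.
have a0 : (0 < area w)%N by lia.
have [u [v ew]] := corner_exists a0.
have step u' v' : w = u' ++ false :: true :: v' ->
  ('C(area w - 1, 3))%:R <= dim (u' ++ true :: false :: v').
  move=> e; have [] := remove_corner u' v'; rewrite /= -e => ea r1 r2.
  have -> : (area w - 1 = area (u' ++ true :: false :: v'))%N by lia.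
  by apply: IH; rewrite /high; lia.
case: (posnP (area u)) => [au|/corner_exists[u1 [v1 eu]]]; last first.
  have e1 : w = u1 ++ false :: true :: (v1 ++ false :: true :: v) by rewrite ew eu -catA.
  apply: (two _ _ (area w - 1)%N _ (step _ _ ew) (step _ _ e1)); first by left.
  rewrite [in dim w]ew; apply: dim_corner2; last by rewrite -ew.
  by rewrite eu size_cat /=; lia.
case: (posnP (area v)) => [av|/corner_exists[u1 [v1 ev]]]; last first.
  have e1 : w = (u ++ false :: true :: u1) ++ false :: true :: v1 by rewrite ew ev -catA.
  apply: (two _ _ (area w - 1)%N _ (step _ _ ew) (step _ _ e1)); first by left.
  rewrite [in dim w]ew; apply: dim_corner2; last by rewrite -ew.
  by rewrite size_cat /=; lia.
(* No corner lies before or after the chosen one, so the partition is a rectangle with r + 1 rows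
   and c + 1 columns. *)
have [a [c eu]] := area0P au; have [r [d ev]] := area0P av.
have er : row1 w = c.+1.
  rewrite ew eu row1_cat /= ev.
  have -> : row1 (nseq r true ++ nseq d false) = 0%N.
    rewrite row1_cat has_nseq andbF; elim: (r) => //= r' ->; by case: ifP.
  by rewrite count_cat !count_nseq /=; lia.
have es : rows w = r.+1.
  rewrite /rows; have -> : conjw w = (conjw v ++ [:: false]) ++ true :: conjw u.
    by rewrite ew conjw_cat !conjw_cons /= -!catA.
  rewrite row1_cat /=.
  have -> : row1 (conjw u) = 0%N.
    rewrite eu /conjw map_cat !map_nseq rev_cat !rev_nseq row1_cat has_nseq andbF.
    by elim: (c) => //= c' ->; case: ifP.
  by rewrite ev /conjw map_cat !map_nseq rev_cat !rev_nseq !count_cat !count_nseq /=; lia.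
have ea : area w = (c.+1 * r.+1)%N.
  rewrite ew area_cat au /= av eu ev !count_cat !count_nseq !size_cat !size_nseq /=; nia.
(* A single row or a single column is not [high]. *)
case: c => [|c] in eu er ea *; first by lia.
case: r => [|r] in ev es ea *; first by lia.
pose w' := (nseq a true ++ nseq c false) ++ false :: true :: false :: true :: (nseq r true ++ nseq d false).
have [eaw r1 r2] := remove_corner u v; move: eaw r1 r2; rewrite -ew.
have -> : u ++ true :: false :: v = w'.
  by rewrite eu ev /w' -[c.+1]addn1 nseqD -!catA.
move=> eaw r1 r2.
have st2 u' v' : w' = u' ++ false :: true :: v' ->
  ('C(area w - 2, 3))%:R <= dim (u' ++ true :: false :: v').
  move=> e; have [] := remove_corner u' v'; rewrite /= -e => ea' r1' r2'.
  have -> : (area w - 2 = area (u' ++ true :: false :: v'))%N by lia.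
  by apply: IH; rewrite /high; nia.
have e1 : w' = (nseq a true ++ nseq c false ++ [:: false; true]) ++ false :: true :: (nseq r true ++ nseq d false).
  by rewrite /w' -!catA.
apply: (two _ _ (area w - 2)%N _ (st2 _ _ erefl) (st2 _ _ e1)); first by right.
apply: le_trans (_ : dim w' <= _).
  by apply: dim_corner2; rewrite -?e1 // !size_cat /=; lia.
rewrite ew; have -> : w' = u ++ true :: false :: v.
  by rewrite eu ev /w' -[c.+1]addn1 nseqD -!catA.
exact: dim_corner.
Qed.

(** * Values bounded by 1 on types with a dominant cycle *)

Lemma nth_remove_hook w p m x : (0 < m)%N -> hook w p m -> x != p -> x != (p + m)%N ->
  nth false (remove_hook w p m) x = nth false w x.
Proof.
move=> m0 /(hookP m0)[u [v [t [-> su -> _ ->]]]] n1 n2.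
rewrite !nth_cat su; case: (ltngtP x p) n1 => // lt _.
have -> : (x - p = (x - p - 1).+1)%N by lia.
rewrite /= !nth_cat; case: ltnP => // le.
have -> : (x - p - 1 - size v = (x - p - 1 - size v - 1).+1)%N by lia.
by [].
Qed.

(** Removing the hook at p changes the word only at p and p + m. As q is free and p + m is occupied,
    these positions are not an end of the hook at q, which can then be removed as well. *)
Lemma area_two_hooks w p q m : (0 < m)%N -> (p < q)%N -> hook w p m -> hook w q m ->
  (2 * m <= area w)%N.
Proof.
move=> m0 lt hp hq.
have [e _] := area_remove_hook m0 hp.
have hq' : hook (remove_hook w p m) q m.
  move: (hq) (hp) => /andP[q1 q2] /andP[p1 p2]; rewrite /hook !nth_remove_hook ?q1 ?q2 //; try lia.
  by apply: contraNneq q1 => ->.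
by have [] := area_remove_hook m0 hq'; lia.
Qed.

Definition unimodular s := forall w, area w = sumn s -> `|mn w s| <= 1.

Lemma unimodular_nil : unimodular [::].
Proof. by move=> w _; rewrite normr1. Qed.

(** More than half of the area is m, so at most one hook of length m can be removed. *)
Lemma unimodular_cons m s : (sumn s < m)%N -> unimodular s -> unimodular (m :: s).
Proof.
move=> lt us w aw; have m0 : (0 < m)%N by lia.
have uniq_hook p q : hook w p m -> hook w q m -> p = q.
  move=> hp hq; case: (ltngtP p q) => // h; move: aw => /=.
    by have := area_two_hooks m0 h hp hq; lia.
  by have := area_two_hooks m0 h hq hp; lia.
rewrite /=; case: (boolP (has (fun p => hook w p m) (index_iota 0 (size w - m)))) => [/hasP[p pr hp]|nh]; last first.
  rewrite big_seq_cond big1 ?normr0 // => p /andP[pr hp].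
  by case/hasP: nh; exists p.
rewrite -big_filter (@eq_in_filter _ _ (pred1 p)) => [|q _]; last first.
  by apply/idP/eqP => [hq|-> //]; apply: uniq_hook.
rewrite filter_pred1_uniq ?iota_uniq // big_seq1 normrM.
have [e _] := area_remove_hook m0 hp.
have -> : `|sgn (count id (between w p m))| = 1 by rewrite /sgn; case: odd.
by rewrite mul1r; apply: us; move: aw e => /=; lia.
Qed.

(** A copy of [mn] on binary integers, for evaluation by [vm_compute]. *)
Fixpoint mnZ w (s : seq nat) : Z :=
  if s is m :: s' then
    foldr (fun p acc => if hook w p m then
       let x := mnZ (remove_hook w p m) s' in
       if odd (count id (between w p m)) then Z.sub acc x else Z.add acc x
      else acc) Z.zero (iota 0 (size w - m))
  else Z.one.

Lemma mnZE w s : Z_of_int (mn w s) = mnZ w s.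
Proof.
elim: s w => [|m s IH] w //=; rewrite /index_iota subn0.
elim: (iota 0 _) => [|p r IHr]; first by rewrite big_nil.
rewrite big_cons /= -IHr -IH /sgn; case: hook => //; case: odd; lia.
Qed.

Lemma unimodular_11 : unimodular [:: 1; 1]%N.
Proof.
move=> w aw; have {}aw : area w = 2 by [].
have := @mem_cores w; rewrite aw => /(_ isT) mc.
rewrite -mn_core //.
have ck : all (fun c => Z.eqb (mnZ c [:: 1; 1]%N) Z.one) (cores 2) by vm_compute.
have := allP ck _ mc; rewrite -mnZE => /Z.eqb_eq/(congr1 int_of_Z).
by rewrite Z_of_intK => ->.
Qed.

(* The weights make T_chi vanish for the three nontrivial constituents. The
   cycle types come in pairs of opposite sign, so that T_chi = 4 chi(1) for the
   conjugates of the partitions (n - k, nu) with k <= 3. *)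
Section Weights.
Variable n : nat.

Definition weighted_types : seq (nat * seq nat) :=
  let x := (2 * ('C(n, 2) - 1))%N in
  let z := ('C(n, 3) + n - 2 * 'C(n, 2))%N in
  let a := ('C(n, 3) - n)%N in
  [:: (x, [:: n]); (x, [:: n - 4; 4]); (z, [:: n - 2; 2]); (z, [:: n - 6; 4; 2]);
      (a, [:: n - 2; 1; 1]); (a, [:: n - 6; 4; 1; 1])]%N.

Definition weighted_sum w : int :=
  dim w *+ 4 + \sum_(x <- weighted_types) x.1%:R * mn w x.2.
End Weights.

(** * Positivity for partitions far from a row and from a column *)

Lemma weights_ge n : (11 <= n)%N ->
  [/\ (1 <= 'C(n, 2))%N, (2 * 'C(n, 2) <= 'C(n, 3) + n)%N & (n <= 'C(n, 3))%N].
Proof.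
move=> le; have [m em] : exists m, n = (m + 11)%N by exists (n - 11)%N; lia.
have := bin2E n; have := bin3E n; rewrite em.
have -> : (m + 11 - 1 = m + 10)%N by lia.
have -> : (m + 11 - 2 = m + 9)%N by lia.
move: ('C(m + 11, 3)) ('C(m + 11, 2)) => A B hA hB; split; [nia| |nia].
have h : (3 * (2 * B) <= 6 * A)%N by rewrite hA hB; nia.
by lia.
Qed.

(** The total weight 4 C(n, 3) - 4 is less than four times the degree. From n = 13 on, n - 6 > 6, so
    the longest cycle exceeds the rest in all six types and [unimodular_cons] applies. *)
Lemma weighted_sum_high13 n w : area w = n -> (13 <= n)%N -> high w -> 0 < weighted_sum n w.
Proof.
move=> aw le hw; have hd := dim_high (w := w); rewrite aw in hd; have {}hd := hd le hw.
have [g1 g2 g3] := @weights_ge n ltac:(lia).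
have um x : x \in weighted_types n -> `|mn w x.2| <= 1.
  have uc m s : unimodular s -> (sumn s < m)%N -> (m + sumn s = n)%N -> `|mn w (m :: s)| <= 1.
    by move=> us lt e; apply: unimodular_cons => //=; rewrite aw e.
  have u1 m : (0 < m)%N -> unimodular [:: m] by move=> m0; apply: unimodular_cons => //; apply: unimodular_nil.
  have u42 : unimodular [:: 4; 2]%N by apply: unimodular_cons => //; apply: u1.
  have u411 : unimodular [:: 4; 1; 1]%N by apply: unimodular_cons => //; apply: unimodular_11.
  rewrite !inE => /orP[/eqP->|/orP[/eqP->|/orP[/eqP->|/orP[/eqP->|/orP[/eqP->|/eqP->]]]]].
  - by apply: uc unimodular_nil _ _ => /=; lia.
  - by apply: uc (u1 4 _) _ _ => //=; lia.
  - by apply: uc (u1 2 _) _ _ => //=; lia.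
  - by apply: uc u42 _ _ => /=; lia.
  - by apply: uc unimodular_11 _ _ => /=; lia.
  - by apply: uc u411 _ _ => /=; lia.
have b x : x \in weighted_types n -> - (x.1%:R) <= x.1%:R * mn w x.2.
  by move/um => h; rewrite -mulrN1 ler_wpM2l // lerNl; move: h; lia.
have : - ((\sum_(x <- weighted_types n) x.1)%N%:R) <= \sum_(x <- weighted_types n) x.1%:R * mn w x.2.
  rewrite natr_sum -sumrN big_seq [leRHS]big_seq; apply: ler_sum; exact: b.
rewrite [X in X%:R](_ : _ = 4 * 'C(n, 3) - 4)%N; last by rewrite !big_cons big_nil /=; lia.
rewrite /weighted_sum; lia.
Qed.

Definition weighted_sumZ n w (d : nat) : Z :=
  foldr (fun x acc => Z.add (Z.mul (Z.of_nat x.1) (mnZ w x.2)) acc) (Z.of_nat (4 * d)) (weighted_types n).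

(** For n = 11 and 12 the cycle of length n - 6 is not longer than the rest, so the sum is evaluated
    for every partition, with the lower bound of the table in place of the degree. *)
Lemma weighted_check :
  all (fun n => all (fun x => high x.1 ==> Z.ltb Z.zero (weighted_sumZ n x.1 x.2)) (dim_table n)) [:: 11; 12]%N.
Proof. by vm_compute. Qed.

Lemma Z_of_int_gt0 x : Z.lt Z.zero (Z_of_int x) -> 0 < x.
Proof. by case: x => [[|k]|k] /=; rewrite /Z.zero; lia. Qed.

Lemma weighted_sumZE n w (d : nat) :
  Z_of_int (d%:R *+ 4 + \sum_(x <- weighted_types n) x.1%:R * mn w x.2) = weighted_sumZ n w d.
Proof.
rewrite /weighted_sumZ; elim: (weighted_types n) => [|x r IH].
  by rewrite big_nil addr0 -mulrnA mulnC -[foldr _ _ _]/(Z.of_nat (4 * d)); lia.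
rewrite big_cons -[foldr _ _ _]/(Z.add (Z.mul (Z.of_nat x.1) (mnZ (w) x.2)) (foldr _ _ _)) -IH -mnZE.
by set S := \sum_(x <- _) _; set M := mn w _; lia.
Qed.

Lemma weighted_types_pos n x : (11 <= n)%N -> x \in weighted_types n -> all (leq 1) x.2.
Proof.
by move=> le; rewrite !inE => /orP[/eqP->|/orP[/eqP->|/orP[/eqP->|/orP[/eqP->|/orP[/eqP->|/eqP->]]]]] /=; lia.
Qed.

Lemma weighted_types_sumn n x : (11 <= n)%N -> x \in weighted_types n -> sumn x.2 = n.
Proof.
by move=> le; rewrite !inE => /orP[/eqP->|/orP[/eqP->|/orP[/eqP->|/orP[/eqP->|/orP[/eqP->|/eqP->]]]]] /=; lia.
Qed.

Lemma weighted_sum_core n w : (11 <= n)%N -> weighted_sum n (core w) = weighted_sum n w.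
Proof.
move=> le; rewrite /weighted_sum dim_core; congr (_ + _).
by rewrite big_seq [RHS]big_seq; apply: eq_bigr => x /(weighted_types_pos le) h; rewrite mn_core.
Qed.

Lemma weighted_sum_high n w : area w = n -> (11 <= n)%N -> high w -> 0 < weighted_sum n w.
Proof.
move=> aw le hw; have [ge13|lt13] := leqP 13 n; first exact: weighted_sum_high13.
have mem : n \in [:: 11; 12]%N by rewrite !inE; lia.
have a0 : (0 < area w)%N by lia.
have [d hd] := mem_dim_table a0; have [_ led] := dim_tableP hd.
rewrite -high_core in hw; rewrite aw in hd.
have := implyP (allP (allP weighted_check _ mem) _ hd) hw; rewrite -weighted_sumZE.
move=> /Z.ltb_lt.
rewrite -[weighted_sum n w]weighted_sum_core // /weighted_sum; set S := \sum_(x <- _) _.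
move/Z_of_int_gt0 => h.
by apply: (lt_le_trans h); rewrite lerD2r lerMn2r led orbT.
Qed.

Lemma nseqSr (T : Type) k (x : T) : nseq k.+1 x = nseq k x ++ [:: x].
Proof. by rewrite -[k.+1]addn1 nseqD. Qed.

(** * Partitions whose first row or column has length at least n - 3 *)

Section LastBead.
Variables (u : seq bool) (b : nat).
Let w := u ++ nseq b false ++ [:: true].
Let L := (size u + b)%N.

(** If p lies beyond u, [set_nth] pads u with [false], which stands for the gap before the moved
    bead. *)
Definition last_bead_value (p : nat) s : int :=
  if nth false u p then 0 else sgn (count id (drop p.+1 u)) * mn (set_nth false u p true) s.

Lemma nth_last_bead x : (size u <= x)%N -> nth false w x = (x == L).
Proof.
move=> le; rewrite /w !nth_cat ltnNge le /= nth_nseq size_nseq.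
case: ltnP => h; first by rewrite /L; lia.
by case e: (x - size u - b)%N => [|d] /=; rewrite ?nth_nil; rewrite /L; lia.
Qed.

(** A hook of length at least [size u] has its upper end beyond u, where the last bead is the only
    one. *)
Lemma mn_last_bead m p s : (0 < m)%N -> all (leq 1) s -> (size u <= m)%N -> (p + m = L)%N ->
  mn w (m :: s) = last_bead_value p s.
Proof.
move=> m0 ps lem epm.
have sw : size w = L.+1 by rewrite /w !size_cat size_nseq /= /L; lia.
have hookE q : hook w q m = (q == p) && ~~ nth false u p.
  rewrite /hook (@nth_last_bead (q + m)); last by lia.
  have -> : (q + m == L)%N = (q == p) by lia.
  case: (q =P p) => [->|]; rewrite ?andbF // andbT /w !nth_cat; case: ltnP => // h.
  rewrite [nth _ u _]nth_default // nth_nseq size_nseq; case: ltnP => // h2; move: epm; rewrite /L; lia.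
rewrite /= (eq_bigl _ _ hookE) /last_bead_value.
case nu: (nth false u p); first by rewrite big1 // => q; rewrite andbF.
rewrite (eq_bigl (pred1 p)) => [|q]; last by rewrite andbT.
have ltp : (p < size w - m)%N by lia.
rewrite big_mkcond (bigD1_seq p) ?iota_uniq ?mem_index_iota //=.
rewrite eqxx big1 ?addr0 => [|q /negPf-> //].
rewrite set_nthE; case: ltnP => [lt|ge].
  have eu : u = take p u ++ false :: drop p.+1 u by rewrite -nu -drop_nth // cat_take_drop.
  have ew : w = take p u ++ false :: (drop p.+1 u ++ nseq b false) ++ true :: [::].
    by rewrite /w {1}eu -!catA.
  have [_] := hook_cat (take p u) (drop p.+1 u ++ nseq b false) [::].
  rewrite -ew size_takel ?(ltnW lt) // (_ : (size (drop _ _ ++ _)).+1 = m); last first.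
    by rewrite size_cat size_drop size_nseq; move: epm; rewrite /L; lia.
  move=> -> ->; rewrite count_cat count_nseq addn0; congr (_ * _).
  by rewrite -[RHS](mn_falses _ b.+1 ps) nseqSr -!catA.
have ew : w = (u ++ nseq (p - size u) false) ++ false :: nseq m.-1 false ++ true :: [::].
  rewrite /w -!catA; congr (u ++ _).
  by rewrite -[false :: _]/(nseq m.-1.+1 false ++ [:: true]) catA -nseqD; congr (nseq _ _ ++ _); move: epm; rewrite /L; lia.
have [_] := hook_cat (u ++ nseq (p - size u) false) (nseq m.-1 false) [::].
rewrite -ew size_cat !size_nseq (_ : (m.-1).+1 = m); last by lia.
rewrite (_ : size u + _ = p)%N; last by lia.
move=> -> ->; rewrite count_nseq mul0n drop_oversize //=; last by lia.
by rewrite -[mn (u ++ ncons _ _ _) s](mn_falses _ m.-1.+1 ps) nseqSr -cat_nseq -!catA /=.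
Qed.
End LastBead.

Lemma core_split w : exists a b, w = nseq a true ++ core w ++ nseq b false.
Proof.
have [a ea] := ltrimE w; have [b eb] := ltrimE (conjw (ltrim w)); exists a, b.
rewrite {1}ea; congr (_ ++ _); rewrite -[LHS]conjwK {1}eb conjw_cat; congr (_ ++ _).
by rewrite /conjw map_nseq rev_nseq.
Qed.

(* The words of the partitions of size at most 3, with the common values of the
   irreducible character of (n - k, nu) on the cycle types (n), (n-4,4), on
   (n-2,2), (n-6,4,2) and on (n-2,1,1), (n-6,4,1,1). *)
Definition low_table : seq (seq bool * (int * int * int)) :=
  [:: ([::], (1, 1, 1)); ([:: false; true], (-1, -1, 1));
      ([:: false; false; true], (0, 1, -1)); ([:: false; true; true], (1, 0, 0));
      ([:: false; false; false; true], (0, -1, -1));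
      ([:: false; true; false; true], (0, 0, 0)); ([:: false; true; true; true], (-1, 0, 0))].

(** The partition (n - k, nu) with padding at both ends: u encodes nu and the bead after it the
    first row. *)
Definition low_word u a b r := nseq a true ++ (u ++ nseq b false ++ [:: true]) ++ nseq r false.

Lemma low_wordP n w : area w = n -> (11 <= n)%N -> (n <= row1 w + 3)%N ->
  exists u a b r, [/\ u \in map fst low_table, w = low_word u a b r & n = (area u + count negb u + b)%N].
Proof.
move=> aw le hw.
have hid : has id w by rewrite -[has _ _]negbK; apply/negP => nh; move: hw; case: (w) nh => [|c v] /=; [|move/negPf=> ->]; lia.
have [u [r ew]] := last_true_split hid; have ew1 := row1_last u r; rewrite -ew in ew1.
have aw1 : area w = (area u + count negb u)%N by rewrite ew -cat1s catA area_trail area_rcons_true.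
have [a [b eu]] := core_split u.
have ecu : count negb u = (count negb (core u) + b)%N.
  by rewrite {1}eu !count_cat !count_nseq /= mul0n add0n mul1n.
exists (core u), a, b, r; split.
- case: (posnP (area u)) => [a0|a0].
    have [a' [b' e0]] := area0P a0; rewrite inE; apply/orP; left; apply/eqP.
    rewrite /core e0; have -> : ltrim (nseq a' true ++ nseq b' false) = nseq b' false.
      by elim: a' {e0} => //=; case: b'.
    rewrite /conjw map_nseq rev_nseq /=; have -> // : ltrim (nseq b' true) = [::] by elim: b' {e0}.
  have au : (area u <= 3)%N by lia.
  have ck : all (fun k => all (fun c => c \in map fst low_table) (cores k)) [:: 1; 2; 3]%N by vm_compute.
  have mk : area u \in [:: 1; 2; 3]%N by rewrite !inE; lia.
  exact: allP (allP ck _ mk) _ (mem_cores a0).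
- by rewrite ew {1}eu /low_word -!catA.
by rewrite area_core -aw aw1 ecu; lia.
Qed.

(** The last bead sits at [size u + b] and n is [area u + count negb u + b], so moving it down by n
    - j takes it to [count id u + j - area u], independently of n and b. If this is negative, there
    is no hook and the value is 0. *)
Definition low_value u j s : int :=
  if (area u <= count id u + j)%N then last_bead_value u (count id u + j - area u) s else 0.

Lemma mn_low_word n u a b r j s : n = (area u + count negb u + b)%N -> (j < n)%N ->
  (size u + j <= n)%N -> all (leq 1) s ->
  mn (low_word u a b r) ((n - j)%N :: s) = low_value u j s.
Proof.
move=> en lj lu ps; have ps' : all (leq 1) ((n - j)%N :: s) by rewrite /= ps; lia.
rewrite /low_word mn_trues // mn_falses //.
have cu : (count id u + count negb u = size u)%N := count_predC id u.
rewrite /low_value; case: ifP => h.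
  by apply: mn_last_bead => //; lia.
by rewrite /= big_geq // !size_cat size_nseq /=; lia.
Qed.

Definition low_valueZ u j s : Z :=
  if (area u <= count id u + j)%N then
    let p := (count id u + j - area u)%N in
    if nth false u p then Z.zero else
    let x := mnZ (set_nth false u p true) s in
    if odd (count id (drop p.+1 u)) then Z.opp x else x
  else Z.zero.

Lemma low_valueZE u j s : low_value u j s = int_of_Z (low_valueZ u j s).
Proof.
rewrite /low_value /low_valueZ /last_bead_value; case: ifP => // _; case: ifP => // _.
apply: (can_inj Z_of_intK); rewrite int_of_ZK -mnZE /sgn; case: odd; rewrite ?mul1r //.
by rewrite mulN1r; lia.
Qed.

Lemma low_tableP u (v : int * int * int) : (u, v) \in low_table ->
  [/\ low_value u 0 [::] = v.1.1 /\ low_value u 4 [:: 4]%N = v.1.1,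
      low_value u 2 [:: 2]%N = v.1.2 /\ low_value u 6 [:: 4; 2]%N = v.1.2 &
      low_value u 2 [:: 1; 1]%N = v.2 /\ low_value u 6 [:: 4; 1; 1]%N = v.2].
Proof.
move=> h; rewrite !low_valueZE.
have ck : all (fun x : seq bool * (int * int * int) => let: (u, v) := x in
  [&& (int_of_Z (low_valueZ u 0 [::]) == v.1.1) && (int_of_Z (low_valueZ u 4 [:: 4]%N) == v.1.1),
      (int_of_Z (low_valueZ u 2 [:: 2]%N) == v.1.2) && (int_of_Z (low_valueZ u 6 [:: 4; 2]%N) == v.1.2),
      int_of_Z (low_valueZ u 2 [:: 1; 1]%N) == v.2 & int_of_Z (low_valueZ u 6 [:: 4; 1; 1]%N) == v.2]) low_table.
  by vm_compute.
by have /and4P[/andP[/eqP-> /eqP->] /andP[/eqP-> /eqP->] /eqP-> /eqP->] := allP ck _ h.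
Qed.

Lemma weighted_sum_low n (u : seq bool) (v : int * int * int) a b r : (11 <= n)%N -> (u, v) \in low_table ->
  n = (area u + count negb u + b)%N ->
  weighted_sum n (low_word u a b r) = dim (low_word u a b r) *+ 4 +
   (2 * ('C(n, 2) - 1))%N%:R * v.1.1 *+ 2 +
   ('C(n, 3) + n - 2 * 'C(n, 2))%N%:R * v.1.2 *+ 2 + ('C(n, 3) - n)%N%:R * v.2 *+ 2
  /\ weighted_sum n (conjw (low_word u a b r)) = dim (low_word u a b r) *+ 4.
Proof.
move=> le h en; have [[e1 e2] [e3 e4] [e5 e6]] := low_tableP h.
have su : (size u <= 4)%N.
  by have : all (fun x => size x.1 <= 4)%N low_table by []; move=> /allP/(_ _ h).
have val j s : (j <= 6)%N -> all (leq 1) s ->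
    mn (low_word u a b r) ((n - j)%N :: s) = low_value u j s.
  move=> lj ps; apply: mn_low_word => //; first by lia.
  by apply: leq_trans (leq_add su lj) _; lia.
have v0 := val 0%N [::]; rewrite subn0 in v0.
have tp x : x \in weighted_types n -> mn (conjw (low_word u a b r)) x.2 = type_sgn x.2 * mn (low_word u a b r) x.2.
  by move=> hx; apply: mn_conjw; apply: (weighted_types_pos le hx).
split; rewrite /weighted_sum.
  rewrite /weighted_types !big_cons big_nil; cbn [fst snd].
  rewrite v0 // !val // e1 e2 e3 e4 e5 e6; ring.
rewrite dim_conjw big_seq (eq_bigr _ (fun x hx => congr1 _ (tp x hx))) -big_seq.
rewrite /weighted_types !big_cons big_nil; cbn [fst snd].
rewrite v0 // !val // e1 e2 e3 e4 e5 e6 /type_sgn !big_cons !big_nil.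
have [m em] : exists m, n = m.+4.+3 by exists (n - 7)%N; lia.
have -> : (n - 4 = m.+3)%N by lia.
have -> : (n - 2 = m.+4.+1)%N by lia.
have -> : (n - 6 = m.+1)%N by lia.
by rewrite [in n.-1]em /sgn /= !negbK; case: odd => /=; ring.
Qed.

(** The degrees of (n-2,2) here and of (n-3,3) in the next lemma, in the form in which they balance
    the weights. *)
Lemma ballot2_bin n : (4 <= n)%N -> (ballot 2 (n - 2) + n = 'C(n, 2))%N.
Proof.
move=> le; have [m em] : exists m, n = (m + 4)%N by exists (n - 4)%N; lia.
have := @ballot2 (n - 2) ltac:(lia); have := bin2E n; move: (ballot 2 (n - 2)) ('C(n, 2)) => B X.
have -> : (n - 2 + 2 = m + 4)%N by lia.
have -> : (n - 2 - 1 = m + 1)%N by lia.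
have -> : (n - 1 = m + 3)%N by lia.
rewrite em => h1 h2; nia.
Qed.
Lemma ballot3_bin n : (6 <= n)%N -> (ballot 3 (n - 3) + 'C(n, 2) = 'C(n, 3))%N.
Proof.
move=> le; have [m em] : exists m, n = (m + 6)%N by exists (n - 6)%N; lia.
have := @ballot3 (n - 3) ltac:(lia); have := bin2E n; have := bin3E n.
move: (ballot 3 (n - 3)) ('C(n, 2)) ('C(n, 3)) => B X Y.
have -> : (n - 3 + 3 = m + 6)%N by lia.
have -> : (n - 3 + 2 = m + 5)%N by lia.
have -> : (n - 3 - 2 = m + 1)%N by lia.
have -> : (n - 1 = m + 5)%N by lia.
have -> : (n - 2 = m + 4)%N by lia.
rewrite em; set p := ((m + 6) * (m + 5))%N => h1 h2 h3.
nia.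
Qed.

Lemma bin2_le_bin3 n : (11 <= n)%N -> (2 * 'C(n, 2) <= 'C(n, 3))%N.
Proof.
move=> le; have [m em] : exists m, n = (m + 11)%N by exists (n - 11)%N; lia.
have := bin2E n; have := bin3E n; move: ('C(n, 2)) ('C(n, 3)) => X Y.
have -> : (n - 1 = m + 10)%N by lia.
have -> : (n - 2 = m + 9)%N by lia.
rewrite em => h1 h2; have : (3 * (2 * (2 * X)) <= 6 * Y)%N by rewrite h1 h2; nia.
by lia.
Qed.

Lemma dim_low_word u a b r : (area u <= count negb u + b)%N ->
  (ballot (area u) (count negb u + b))%:R <= dim (low_word u a b r).
Proof.
move=> le; have := @dim_ge_ballot (nseq a true ++ u ++ nseq b false) r.
have -> : area (nseq a true ++ u ++ nseq b false) = area u by rewrite area_trues area_trail.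
have -> : count negb (nseq a true ++ u ++ nseq b false) = (count negb u + b)%N.
  by rewrite !count_cat !count_nseq /= mul0n add0n mul1n.
by rewrite /low_word -!catA => /(_ le).
Qed.

(** The lower bounds [ballot] for the degrees are enough: for (n-k,k) with k = 1, 2, 3 they balance
    the weights exactly and give a nonnegative sum, and for the other four shapes of [low_table] the
    sum is positive. *)
Lemma weighted_sum_sign n w : area w = n -> (11 <= n)%N ->
  0 < weighted_sum n w \/ 0 <= weighted_sum n w /\
  exists k a b r, [/\ (k <= 3)%N, w = low_word (nseq k false ++ [:: true]) a b r & n = (2 * k + b)%N].
Proof.
move=> aw le; have [hw|] := boolP (high w); first by left; apply: weighted_sum_high.
rewrite /high negb_and -!ltnNge aw => /orP[low|low]; last first.
  left; have aw' : area (conjw w) = n by rewrite area_conjw.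
  have [|u [a [b [r [/mapP[[u' v] hu /= ->] ew en]]]]] := low_wordP aw' le; first by rewrite -/(rows w); lia.
  have [_] := weighted_sum_low a r le hu en.
  by rewrite -ew conjwK => ->; rewrite pmulrn_lgt0 ?dim_gt0.
have [|u [a [b [r [/mapP[[u' v] hu /= ->] ew en]]]]] := low_wordP aw le; first by lia.
have [eT _] := weighted_sum_low a r le hu en; rewrite -ew in eT.
have := @dim_low_word u' a b r; rewrite -ew; have := dim_gt0 w.
have [g1 g2 g3] := weights_ge le; have b2 := bin2E n; have b3 := bin3E n.
have hx : (2 * ('C(n, 2) - 1))%N%:R = 2 * 'C(n, 2)%:R - 2 :> int by lia.
have hz : ('C(n, 3) + n - 2 * 'C(n, 2))%N%:R = 'C(n, 3)%:R + n%:R - 2 * 'C(n, 2)%:R :> int by lia.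
have ha : ('C(n, 3) - n)%N%:R = 'C(n, 3)%:R - n%:R :> int by lia.
have k2 := @ballot2_bin n ltac:(lia); have k3 := @ballot3_bin n ltac:(lia).
rewrite {}eT {}hx {}hz {}ha; move: (bin2_le_bin3 le) k2 k3; move: (dim w) ('C(n, 3)) ('C(n, 2)) g1 g2 g3 b2 b3 => d Y X g1 g2 g3 b2 b3 g4 k2 k3.
move: hu; rewrite !inE => /orP[|/orP[|/orP[|/orP[|/orP[|/orP[|]]]]]] /eqP[eu ev];
  move: ew en; rewrite {}eu {}ev => ew en d0 hd.
- by left; rewrite /= ?mulr1; lia.
-   have {}hd : ((1 <= 1 + b)%N -> (ballot 1 (1 + b))%:R <= d) := hd.
  have {}en : n = (1 + 1 + b)%N := en.
  right; split; last by exists 1%N, a, b, r; split=> //; lia.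
  rewrite ballot1 in hd; last by lia.
  have {}hd := hd ltac:(lia); rewrite /= ?mulr1 ?mulrN1; lia.
-   have {}hd : ((2 <= 2 + b)%N -> (ballot 2 (2 + b))%:R <= d) := hd.
  have {}en : n = (2 + 2 + b)%N := en.
  right; split; last by exists 2%N, a, b, r; split=> //; lia.
  move: k2; rewrite (_ : n - 2 = 2 + b)%N; last by lia.
  have {}hd := hd ltac:(lia).
  cbn [fst snd]; rewrite ?mulr1 ?mulrN1 ?mulr0; move: hd; move: (ballot 2 (2 + b)) => B; lia.
- by left; rewrite /= ?mulr1 ?mulr0; lia.
-   have {}hd : ((3 <= 3 + b)%N -> (ballot 3 (3 + b))%:R <= d) := hd.
  have {}en : n = (3 + 3 + b)%N := en.
  right; split; last by exists 3%N, a, b, r; split=> //; lia.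
  move: k3; rewrite (_ : n - 3 = 3 + b)%N; last by lia.
  have {}hd := hd ltac:(lia).
  cbn [fst snd]; rewrite ?mulr1 ?mulrN1 ?mulr0; move: hd; move: (ballot 3 (3 + b)) => B; lia.
- by left; rewrite /= ?mulr1 ?mulr0; lia.
(* For (n-3,1,1,1) the values -1 cost 4(C(n, 2) - 1), and the degree is at least C(n, 3) - C(n, 2)
   >= C(n, 2). *)
have {}hd : ((3 <= 1 + b)%N -> (ballot 3 (1 + b))%:R <= d) := hd.
have {}en : n = (3 + 1 + b)%N := en.
left; move: k3; rewrite (_ : n - 3 = 1 + b)%N; last by lia.
have {}hd := hd ltac:(lia).
cbn [fst snd]; rewrite ?mulr1 ?mulrN1 ?mulr0; move: hd; move: (ballot 3 (1 + b)) => B; lia.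
Qed.

End BoundaryWords.

(** * Character energies and isotypic projections *)

Section CharacterSums.
Variables (gT : finGroupType) (G : {group gT}) (F : {set gT}) (i : Iirr G).
Hypothesis sFG : F \subset G.

Definition char_energy : algC := \sum_(s in F) \sum_(t in F) 'chi_i (s * t^-1)%g.

Lemma irr_mulC x y : x \in G -> y \in G -> 'chi_i (x * y)%g = 'chi_i (y * x)%g.
Proof. by move=> Gx Gy; rewrite -(cfunJ 'chi_i (y * x)%g Gy) conjgE mulgA mulKg. Qed.

(** By generalized orthogonality chi(s t^-1) is chi(1)/|G| times the inner product of the functions
    chi(s h) and chi(t h) of h, so the energy is a squared norm. *)
Lemma char_energyE : char_energy =
  'chi_i 1%g / #|G|%:R * \sum_(h in G) `|\sum_(s in F) 'chi_i (s * h)%g| ^+ 2.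
Proof.
have inF s : s \in F -> s \in G by apply: (subsetP sFG).
have nzG : #|G|%:R != 0 :> algC by apply: neq0CG.
under eq_bigr => h Gh.
  rewrite normCK rmorph_sum big_distrlr /=; over.
rewrite exchange_big /= mulr_sumr; apply: eq_bigr => s Fs.
rewrite exchange_big /= mulr_sumr; apply: eq_bigr => t Ft.
have := generalized_orthogonality_relation (s * t^-1)%g i i; rewrite eqxx mul1r => e.
apply: (mulIf (invr_neq0 (irr1_neq0 i))); rewrite -e.
rewrite [RHS]mulrC !mulrA mulVf ?irr1_neq0 // mul1r; congr (_ * _).
rewrite [RHS](reindex_inj (mulgI t^-1%g)); apply: eq_big => [x|x Gx].
  by rewrite (groupMl _ (groupVr (inF _ Ft))).
have Gs := inF _ Fs; have Gt := inF _ Ft.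
by rewrite mulKVg -irr_inv irr_mulC ?groupM ?groupV // -mulgA.
Qed.

Lemma char_energy_ge0 : 0 <= char_energy.
Proof.
rewrite char_energyE mulr_ge0 ?divr_ge0 ?ler0n ?(ltW (irr1_gt0 i)) //.
by apply: sumr_ge0 => h _; rewrite exprn_ge0.
Qed.

Lemma char_energy_eq0 h : char_energy = 0 -> h \in G -> \sum_(s in F) 'chi_i (s * h)%g = 0.
Proof.
move/eqP; rewrite char_energyE mulf_eq0 mulf_eq0 invr_eq0 (negPf (neq0CG G)) (negPf (irr1_neq0 i)) /=.
rewrite psumr_eq0 => [/allP z Gh|x _]; last by rewrite exprn_ge0.
have := z h; rewrite mem_index_enum Gh => /(_ isT) /=.
by rewrite expf_eq0 normr_eq0 => /eqP.
Qed.
End CharacterSums.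

(** With A the sum of F in the group algebra and e_i the central idempotent of chi_i, the
    coefficient of A e_i at h is chi_i(1)/|G| times the sum of chi_i(s h^-1) over s in F. So only
    the components in P survive. *)
Lemma gring_row_sub_isotypic (gT : finGroupType) (G : {group gT}) (P : pred (Iirr G)) (F : {set gT}) :
  F \subset G ->
  (forall i h, ~~ P i -> h \in G -> \sum_(s in F) 'chi_i (s * h)%g = 0) ->
  ((\sum_(g in F) (delta_mx 0 (gring_index G g) : 'rV[algC]_#|G|))%R <= \sum_(i | P i) (socle_of_Iirr i : 'M[algC]_#|G|))%MS.
Proof.
move=> sFG z; have inF s : s \in F -> s \in G by apply: (subsetP sFG).
pose aG := regular_repr algC G; pose A := \sum_(g in F) aG g.
have RA : (A \in group_ring algC G)%MS.
  rewrite linear_sum summx_sub // => g Fg; exact: envelop_mx_id (inF _ Fg).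
have -> : \sum_(g in F) delta_mx 0 (gring_index G g) = gring_row A.
  rewrite linear_sum; apply: eq_bigr => g Fg.
  by rewrite -[RHS]/(row (gring_index G 1) (regular_mx algC G g)) rowK gring_indexK // mul1g.
have eA : A = \sum_i A *m Wedderburn_id (socle_of_Iirr i).
  rewrite -mulmx_sumr -(reindex _ (socle_of_Iirr_bij predT)) /=.
  by rewrite Wedderburn_sum_id_pchar ?mulmx1 //; exact: algC'G_pchar.
rewrite eA linear_sum; apply: summx_sub => i _.
have [Pi|nPi] := boolP (P i).
  apply: (sumsmx_sup i) => //.
  have : (A *m Wedderburn_id (socle_of_Iirr i) \in Wedderburn_subring (socle_of_Iirr i))%MS.
    have /andP[h _] := Wedderburn_ideal (socle_of_Iirr i); apply: submx_trans h.
    by rewrite mem_mulsmx ?Wedderburn_id_mem.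
  by rewrite genmxE mem_sub_gring => /andP[].
suff -> : A *m Wedderburn_id (socle_of_Iirr i) = 0 by rewrite linear0 sub0mx.
rewrite Wedderburn_id_expansion -scalemxAr mulmx_suml.
have E s : s \in F -> aG s *m (\sum_(x in G) 'chi_i 1%g * 'chi_i x^-1%g *: aG x) =
   \sum_(h in G) 'chi_i 1%g * 'chi_i (s * h^-1)%g *: aG h.
  move=> Fs; have Gs := inF _ Fs; rewrite mulmx_sumr [RHS](reindex_inj (mulgI s)).
  apply: eq_big => [x|x Gx]; first by rewrite (groupMl _ Gs).
  by rewrite -scalemxAr -repr_mxM // invMg irr_mulC ?mulgKV ?groupM ?groupV.
rewrite (eq_bigr _ E) exchange_big /= big1 ?scaler0 // => h Gh.
by rewrite -scaler_suml -mulr_sumr z ?mulr0 ?scale0r ?groupV.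
Qed.

(** * Weighted permutations without invariant 3-sets *)

Fixpoint subset_sum (s : seq nat) k : bool :=
  if s is m :: s' then subset_sum s' k || ((m <= k)%N && subset_sum s' (k - m)%N) else k == 0%N.

Lemma subset_sumP s (e : 'I_(size s) -> bool) :
  subset_sum s (\sum_(t < size s) nth 0 s t * e t)%N.
Proof.
elim: s e => [|m s IH] e /=; first by rewrite big_ord0.
rewrite big_ord_recl /=.
have -> : (\sum_(i < size s) nth 0 (m :: s) (lift ord0 i) * e (lift ord0 i) =
  \sum_(i < size s) nth 0 s i * e (lift ord0 i))%N by [].
have := IH (fun t => e (lift ord0 t)); case: (e ord0) => h; last by rewrite muln0 add0n h.
by rewrite muln1 leq_addr addKn h orbT.
Qed.

Lemma cycle_type_pos n (g : 'S_n) s : has_cycle_type g s -> all (leq 1) s.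
Proof.
case=> B [r [_ rK cB _]]; apply/(all_nthP 0%N) => t lt; rewrite -(cB (Ordinal lt)).
by apply/card_gt0P; exists (r (Ordinal lt)); rewrite inE rK.
Qed.

Lemma cycle_type_sumn n (g : 'S_n) s : has_cycle_type g s -> sumn s = n.
Proof.
case=> B [r [_ _ cB _]]; rewrite sumnE (big_nth 0%N) big_mkord -[RHS]card_ord -sum1_card.
rewrite (partition_big B predT) //=; apply: eq_bigr => t _; rewrite -cB -sum1_card.
by apply: eq_bigl => x; rewrite inE.
Qed.

(** An invariant set is a union of cycles, so its size is a sum of cycle lengths. *)
Lemma invariant_set_card n (g : 'S_n) s (S : {set 'I_n}) :
  has_cycle_type g s -> g @: S = S -> subset_sum s #|S|.
Proof.
case=> B [r [_ rK cB inv]] gS.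
have h : color_inv g [ffun x => x \in S].
  by apply/forallP => x; rewrite !ffunE -{1}gS mem_imset //; apply: perm_inj.
have -> : #|S| = (\sum_(t < size s) nth 0 s t * (r t \in S))%N.
  rewrite -sum1_card (partition_big B predT) //=; apply: eq_bigr => t _; rewrite -cB.
  have e x : (x \in S) = (r (B x) \in S) by have := inv _ _ h x; rewrite !ffunE.
  case St: (r t \in S); rewrite ?muln1 ?muln0.
    rewrite -sum1_card; apply: eq_bigl => x; rewrite inE e.
    by case: (B x =P t) => [->|]; rewrite ?St ?andbF.
  by rewrite big1 // => x /andP[]; rewrite e => + /eqP Bx; rewrite Bx St.
exact: subset_sumP.
Qed.

Definition derangement3 n (g : 'S_n) := forall S : {set 'I_n}, #|S| = 3%N -> g @: S <> S.

Lemma weighted_perms n : (11 <= n)%N -> exists L : seq (nat * 'S_n),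
  (forall y, y \in L -> derangement3 y.2) /\
  forall (i : Iirr (SymG n)) w,
   (forall g s, has_cycle_type g s -> all (leq 1) s -> sumn s = n -> 'chi_i g = (mn w s)%:~R) ->
   \sum_(y <- L) y.1%:R * 'chi_i y.2 = (\sum_(x <- weighted_types n) x.1%:R * mn w x.2)%:~R.
Proof.
(* The parts below 4 are none, a single 2, or 1 and 1, so no subset of the parts sums to 3. *)
move=> le; have ns x : x \in weighted_types n -> ~~ subset_sum x.2 3.
  rewrite !inE => /orP[/eqP->|/orP[/eqP->|/orP[/eqP->|/orP[/eqP->|/orP[/eqP->|/eqP->]]]]] /=; lia.
have : all (fun x => [&& ~~ subset_sum x.2 3, all (leq 1) x.2 & sumn x.2 == n]) (weighted_types n).
  by apply/allP => x hx; rewrite (ns _ hx) (weighted_types_pos le hx) (weighted_types_sumn le hx) eqxx.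
elim: (weighted_types n) => [_|x r IH /= /andP[/and3P[n3 px /eqP sx] /IH[L [dL eL]]]].
  by exists [::]; split=> // i w _; rewrite !big_nil.
have [g hg] := cycle_type_perm_exists px sx.
exists ((x.1, g) :: L); split=> [y|i w hw].
  rewrite inE => /predU1P[-> S cS gS|]; last exact: dL.
  by have := invariant_set_card hg gS; rewrite cS (negPf n3).
by rewrite !big_cons /= (eL i w hw) (hw g x.2) // rmorphD rmorphM /= mulrz_nat.
Qed.

(** * The permutation character on 3-sets *)

Section TwoRows.
Variable n : nat.
Hypothesis le : (11 <= n)%N.

(** The beta-numbers of (n-k,k) in increasing order. *)
Definition two_row_beads k (j : 'I_2) : nat := if j == ord0 then k else (n - k + 1)%N.

Lemma det2 (A : 'M[int]_2) : \det A = A ord0 ord0 * A ord_max ord_max - A ord0 ord_max * A ord_max ord0.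
Proof.
rewrite (expand_det_row _ ord0) !big_ord_recl big_ord0 addr0 /cofactor !det_mx11 !mxE /= expr0 expr1 mul1r mulN1r mulrN.
by congr (A _ _ * A _ _ - A _ _ * A _ _); apply: val_inj.
Qed.

Lemma sum_two_row_beads k : (k <= n)%N -> (\sum_j two_row_beads k j = n + 'C(2, 2))%N.
Proof. by move=> lk; rewrite !big_ord_recl big_ord0 /two_row_beads /= binn; lia. Qed.

Lemma two_row_match k k' : (k <= 3)%N -> (k' <= 3)%N ->
  match_det (two_row_beads k) (two_row_beads k') = (k == k')%:R.
Proof.
move=> lk lk'; rewrite /match_det det2 !mxE /two_row_beads /=.
have -> : (k == n - k' + 1)%N = false by lia.
have -> : (n - k + 1 == n - k' + 1)%N = (k == k') by lia.
by rewrite mul0r subr0 -natrM mulnb andbb.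
Qed.

(** A 3-set is a two-coloring with three points of the first color. On content (x, n - x) the
    determinant for k is [x = k] - [x + 1 = k], and the sum over k = 0, ..., 3 telescopes to
    [x = 3]. *)
Lemma perm_char3_frob g : perm_char3 g = \sum_(k < 4) frob n (two_row_beads k) g.
Proof.
under eq_bigr => k _ do rewrite frobE.
rewrite -rmorph_sum exchange_big /=.
transitivity ((\sum_(d : {ffun 'I_n -> 'I_2} | color_inv g d) (content d ord0 == 3)%:R)%:~R : algC); last first.
  congr (_%:~R); apply: eq_bigr => d _.
  have sd := sum_content d; rewrite !big_ord_recl big_ord0 in sd.
  rewrite !big_ord_recl big_ord0 /shift_det !det2 !mxE /two_row_beads /=.
  move: sd; rewrite (_ : lift ord0 ord0 = ord_max :> 'I_2); last exact: val_inj.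
  move: (content d ord0) (content d ord_max) => x y sd.
  rewrite addn0 in sd; have tel k : (k <= 3)%N ->
      (k == x + 0)%N%:R * (n - k + 1 == y + 1)%N%:R - (k == x + 1)%N%:R * (n - k + 1 == y + 0)%N%:R
      = (x == k)%:R - (x.+1 == k)%:R :> int.
    move=> lk; rewrite addn0 addn1 addn0 ![k == _]eq_sym -!natrM !mulnb.
    by congr ((nat_of_bool _)%:R - (nat_of_bool _)%:R); case: eqP => //= e; lia.
  by rewrite !tel //; case: x {sd tel} => [|[|[|[|x]]]].
pose f (S : {set 'I_n}) : {ffun 'I_n -> 'I_2} := [ffun x => if x \in S then ord0 else ord_max].
pose f' (d : {ffun 'I_n -> 'I_2}) := [set x | d x == ord0].
rewrite /perm_char3 -mulrz_nat; congr (_%:~R).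
rewrite (reindex_onto f f') /= => [|d _]; last first.
  apply/ffunP => x; rewrite ffunE inE; case: eqP => [-> //|]; case: (d x) => [[|[|//]] h] ne; last exact: val_inj.
  by case: ne; apply: val_inj.
have fK S : f' (f S) = S by apply/setP => x; rewrite inE ffunE; case: (x \in S).
rewrite -sum1_card natr_sum [RHS]big_mkcond [LHS]big_mkcond; apply: eq_bigr => S _.
rewrite fK eqxx andbT !inE /content -/(f' (f S)) fK.
have -> : color_inv g (f S) = (g @: S == S).
  apply/forallP/eqP => [h|gS x].
    apply/eqP; rewrite eqEcard card_imset ?leqnn ?andbT; last exact: perm_inj.
    apply/subsetP => _ /imsetP[x Sx ->]; have := h x; rewrite !ffunE Sx; by case: ifP.
  by rewrite !ffunE -{1}gS mem_imset //; apply: perm_inj.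
by case: (g @: S == S); rewrite ?andbF ?andbT //; case: eqP.
Qed.

(** The irreducible characters were obtained with n beads and [two_row_beads] has two, but the
    values of both are [mn] of the same word up to padding. So chi_i is one of the four orthonormal
    summands of [perm_char3]. *)
Lemma two_row_constituent (i : Iirr (SymG n)) w k a b r :
  (forall g s, has_cycle_type g s -> all (leq 1) s -> sumn s = n -> 'chi_i g = (mn w s)%:~R) ->
  (k <= 3)%N -> w = low_word (nseq k false ++ [:: true]) a b r -> n = (2 * k + b)%N ->
  constituent3 i.
Proof.
move=> hw lk ew en.
have ei : 'chi_i = frob n (two_row_beads k).
  apply/cfunP => g; have [s hs] := cycle_type_exists g.
  have ps := cycle_type_pos hs; have ss := cycle_type_sumn hs.
  rewrite (hw _ _ hs ps ss) (frob_mnv _ hs); congr (_%:~R).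
  rewrite ew /low_word mn_trues // mn_falses //.
  set v := (_ ++ _); have cv : count id v = 2.
    by rewrite /v !count_cat !count_nseq /= mul0n.
  have av : area v = sumn s.
    rewrite ss /v !area_cat /= !count_cat !size_cat !count_nseq !size_nseq /= [area (nseq b _)](area_trail [::] b) [area (nseq k _)](area_trail [::] k) /=.
    by rewrite !mul0n; lia.
  rewrite -(mnl_word cv av ps); apply: mnv_eq => j.
  have -> : beads 0 v = [:: k; (n - k + 1)%N].
    have bf c m : beads c (nseq m false) = [::] by elim: m c => /=.
    by rewrite /v !beads_cat !bf /= !size_nseq size_cat size_nseq /=; congr [:: _; _]; lia.
  by rewrite /two_row_beads; case: j => [[|[|//]] h].
rewrite /constituent3 ei.
have nzG : #|SymG n|%:R != 0 :> algC by apply: neq0CG.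
suff -> : \sum_(g in SymG n) perm_char3 g * (frob n (two_row_beads k) g)^* = #|SymG n|%:R by [].
under eq_bigr => g _ do rewrite perm_char3_frob mulr_suml.
rewrite exchange_big /=; apply: (mulfI (invr_neq0 nzG)); rewrite mulVf // mulr_sumr.
transitivity (\sum_(k' < 4) '[frob n (two_row_beads k'), frob n (two_row_beads k)]).
  by apply: eq_bigr => k' _; rewrite cfdotE.
have lk4 : (k < 4)%N by [].
rewrite (bigD1 (Ordinal lk4)) //= big1 ?addr0 => [|k' nk].
  by rewrite frob_dot ?sum_two_row_beads ?two_row_match ?eqxx //; lia.
have lk' : (k' <= 3)%N by rewrite -ltnS.
rewrite frob_dot ?sum_two_row_beads ?two_row_match //; try lia.
by have /negPf-> : k' != k :> nat by [].
Qed.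

Lemma constituent3_trivial : constituent3 (0 : Iirr (SymG n)).
Proof.
rewrite /constituent3 gt_eqF // (bigD1 1%g) ?inE //= irr0 cfun1E inE conjC1 mulr1.
apply: ltr_pwDl.
  rewrite /perm_char3 ltr0n; apply/card_gt0P.
  have /card_gt0P[S] : (0 < #|[set S : {set 'I_n} | #|S| == 3]|)%N.
    by rewrite card_draws card_ord bin_gt0; lia.
  rewrite inE => cS.
  exists S; rewrite !inE cS /=; apply/eqP/setP => x; apply/imsetP/idP => [[y Sy ->]|Sx]; first by rewrite perm1.
  by exists x; rewrite ?perm1.
apply: sumr_ge0 => g _; rewrite cfun1E inE conjC1 mulr1 /perm_char3; exact: ler0n.
Qed.
End TwoRows.

(** * The ratio bound and the case of equality *)

Section Bound.
Variables (n : nat) (F : {set 'S_n}).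
Hypotheses (le : (11 <= n)%N) (interF : setwise3_family F).

Lemma quotient_fixes s t : s \in F -> t \in F -> ~ derangement3 (s * t^-1)%g.
Proof.
move=> Fs Ft d; have [S cS e] := interF Fs Ft; apply: (d S cS).
apply/setP => x; apply/imsetP/idP => [[y Sy ->]|Sx].
  have : s y \in t @: S by rewrite -e imset_f.
  by case/imsetP=> z Sz ez; rewrite permM ez permK.
have : t x \in s @: S by rewrite e imset_f.
by case/imsetP=> z Sz ez; exists z => //; rewrite permM -ez permK.
Qed.

Lemma derangement3_conj (g h : 'S_n) : derangement3 (g ^ h)%g -> derangement3 g.
Proof.
move=> d S cS gS; apply: (d (h @: S)); first by rewrite card_imset //; apply: perm_inj.
rewrite -[in RHS]gS -!imset_comp; apply: eq_imset => x /=.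
by rewrite conjgE !permM permK.
Qed.

Lemma weighted_energy : exists T : Iirr (SymG n) -> int,
  [/\ T 0 = ('C(n, 3) * 4)%N%:Z,
      \sum_i (T i)%:~R * char_energy F i = (4 * n`! * #|F|)%:R :> algC &
      forall i, 0 < T i \/ 0 <= T i /\ constituent3 i].
Proof.
have [wf hw] := fin_all_exists (@irr_word n).
have hw3 i : forall g s, has_cycle_type g s -> all (leq 1) s -> sumn s = n ->
  'chi_i g = (mn (wf i) s)%:~R by case: (hw i).
have [L [dL eL]] := weighted_perms le.
have chi1 i : 'chi_i 1%g = (dim (wf i))%:~R.
  case: (hw i) => _ aw h; rewrite (h _ _ (cycle_type1 n)) ?all_nseq ?orbT ?sumn_nseq ?mul1n //.
  by rewrite /dim aw.
have chiR (i : Iirr (SymG n)) g : ('chi_i g)^* = 'chi_i g.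
  have [s hs] := cycle_type_exists g.
  by rewrite (hw3 i _ _ hs (cycle_type_pos hs) (cycle_type_sumn hs)) rmorph_int.
have [g1 g2 g3] := weights_ge le.
exists (fun i => weighted_sum n (wf i)); split=> [||i].
- have one s : all (leq 1) s -> sumn s = n -> mn (wf 0) s = 1.
    move=> ps ss; have [g hg] := cycle_type_perm_exists ps ss.
    by apply: (@intr_inj algC); rewrite -(hw3 0 _ _ hg ps ss) irr0 cfun1E inE.
  rewrite /weighted_sum big_seq.
  rewrite (eq_bigr (fun x => x.1%:R)) => [|x hx]; last first.
    by rewrite one ?mulr1 // ?(weighted_types_pos le hx) ?(weighted_types_sumn le hx).
  have -> : dim (wf 0) = 1 by apply: (@intr_inj algC); rewrite -chi1 irr0 cfun1E inE.
  rewrite -big_seq /weighted_types !big_cons big_nil /=; lia.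
- transitivity (\sum_(s in F) \sum_(t in F) \sum_(i : Iirr (SymG n))
     ('chi_i (s * t^-1)%g * ('chi_i 1%g)^* *+ 4 +
      \sum_(y <- L) y.1%:R * ('chi_i (s * t^-1)%g * ('chi_i y.2)^*)) : algC).
    under eq_bigr => i _ do rewrite /char_energy mulr_sumr.
    rewrite exchange_big /=; apply: eq_bigr => s _.
    under eq_bigr => i _ do rewrite mulr_sumr.
    rewrite exchange_big /=; apply: eq_bigr => t _; apply: eq_bigr => i _.
    rewrite /weighted_sum rmorphD /= -(eL i _ (hw3 i)) rmorphMn /= -chi1 mulrDl mulr_suml chiR.
    congr (_ + _); first by rewrite mulrnAl mulrC.
    by apply: eq_bigr => y _; rewrite chiR -mulrA [X in _ * X]mulrC.
  transitivity (\sum_(s in F) \sum_(t in F) ((n`! * 4)%:R *+ (s == t)) : algC).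
    apply: eq_bigr => s Fs; apply: eq_bigr => t Ft.
    rewrite big_split /= exchange_big /= [X in _ + X]big_seq [X in _ + X]big1 => [|y Ly]; last first.
      rewrite -mulr_sumr second_orthogonality_relation ?inE //.
      have -> : ((s * t^-1)%g \in y.2 ^: SymG n) = false; last by rewrite mulr0.
      apply/negP => /imsetP[h _ e]; apply: (quotient_fixes Fs Ft).
      have := dL y Ly; rewrite e => d; apply: (@derangement3_conj _ h^-1%g); by rewrite conjgK.
    rewrite addr0 sumrMnl second_orthogonality_relation ?inE // class1G inE.
    have -> : ((s * t^-1)%g == 1%g) = (s == t) by rewrite -eq_mulgV1.
    case: eqP => [->|]; last by rewrite !mulr0n mul0rn.
    rewrite !mulr1n mulgV cent11T setIT cardsT card_Sn natrM mulr_natr //.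
  under eq_bigr => s Fs.
    rewrite (bigD1 s) //= eqxx mulr1n big1 ?addr0; last by move=> t /andP[_ /negPf]; rewrite eq_sym => ->.
    over.
  by rewrite sumr_const -mulrnA; congr (_%:R); lia.
case: (hw i) => _ aw h; case: (weighted_sum_sign aw le); first by left.
case=> h0 [k [a [b [r [lk ew en]]]]]; right; split=> //.
exact: (two_row_constituent le h lk ew en).
Qed.

Lemma char_energy0 : char_energy F (0 : Iirr (SymG n)) = (#|F| ^ 2)%:R.
Proof.
rewrite /char_energy; under eq_bigr => s _ do under eq_bigr => t _ do rewrite irr0 cfun1E inE /=.
by rewrite !sumr_const -mulrnA mulnn.
Qed.

Lemma factE : (n`! = 'C(n, 3) * (6 * (n - 3)`!))%N.
Proof. by rewrite -(bin_fact (_ : 3 <= n)%N) //; lia. Qed.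

End Bound.

Theorem theorem1p3 (n : nat) (F : {set 'S_n}) :
  (11 <= n)%N -> setwise3_family F ->
  (#|F| <= 6 * (n - 3)`!)%N /\
  ((#|F| = 6 * (n - 3)`!)%N -> (char_vec F <= U_constituents3 n)%MS).
Proof.
move=> le interF.
have sFG : F \subset SymG n by apply: subsetT.
have [T [T0 eT posT]] := weighted_energy le interF.
have T_ge0 i : 0 <= T i by case: (posT i) => [/ltW|[]].
have C0 : (0 < 'C(n, 3))%N by rewrite bin_gt0; lia.
have term_ge0 i : 0 <= (T i)%:~R * char_energy F i :> algC.
  by rewrite mulr_ge0 ?ler0z ?char_energy_ge0.
move: eT; rewrite (bigD1 0) //= T0 char_energy0 => eT.
have e0 : (('C(n, 3) * 4)%N%:Z)%:~R * (#|F| ^ 2)%:R = (4 * ('C(n, 3) * #|F|) * #|F|)%:R :> algC.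
  by rewrite -[_%:~R]/(_%:R) -natrM; congr (_%:R); lia.
have bound : (#|F| <= 6 * (n - 3)`!)%N.
  case: (posnP #|F|) => [->//|F0].
  have : (4 * ('C(n, 3) * #|F|) * #|F|)%:R <= (4 * n`! * #|F|)%:R :> algC.
    by rewrite -eT e0 lerDl; apply: sumr_ge0 => i _.
  rewrite ler_nat leq_pmul2r // leq_pmul2l // factE // leq_pmul2l //.
split=> // eF; apply: (gring_row_sub_isotypic (P := @constituent3 n) sFG) => i h nc Gh.
apply: char_energy_eq0 => //.
have /eqP : \sum_(j | j != 0) (T j)%:~R * char_energy F j = 0 :> algC.
  apply: (addrI ((4 * ('C(n, 3) * #|F|) * #|F|)%:R)); rewrite -{1}e0 eT addr0.
  by rewrite (factE le) -eF.
rewrite psumr_eq0 // => /allP /(_ i); rewrite mem_index_enum => /(_ isT).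
have Ti : 0 < T i by case: (posT i) => [//|[_ ci]]; rewrite ci in nc.
have -> : i != 0 by apply: contraNneq nc => ->; apply: constituent3_trivial.
by rewrite /= mulf_eq0 intr_eq0 gt_eqF //= => /eqP.
Qed.
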